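(* For every table of dimensions $T$ (that is, every object of $\widetilde\Theta$), the free strict $\infty$-groupoid $L(G_T)$ on the globular set $G_T$ is weakly contractible.
   Context: Globe category. $\mathbb{G}$ has objects $D_0,D_1,\dots$ and is generated by $\sigma_i,\tau_i:D_{i-1}\to D_i$ ($i\ge1$) subject to $\sigma_{i+1}\sigma_i=\tau_{i+1}\sigma_i$ and $\sigma_{i+1}\tau_i=\tau_{i+1}\tau_i$. For $i\ge j$, $\sigma^i_j=\sigma_i\cdots\sigma_{j+1}$ and $\tau^i_j=\tau_i\cdots\tau_{j+1}$, from $D_j$ to $D_i$. A globular set is a presheaf on $\mathbb{G}$; $\mathbb{G}$ is regarded as a full subcategory of globular sets by Yoneda. Strict $\infty$-groupoids. A strict $\infty$-category is a globular set $G$ (sets $G_i$ of $i$-arrows, source and target maps $s_i,t_i:G_i\to G_{i-1}$, iterated to $s^i_j,t^i_j:G_i\to G_j$) with compositions $u\ast^i_j v$ for $i$-arrows with $s^i_j(u)=t^i_j(v)$, $i>j\ge0$, and identities $k_i:G_i\to G_{i+1}$, satisfying the usual source/target, associativity, exchange, identity and functoriality-of-identities axioms. It is a strict $\infty$-groupoid if every $i$-arrow $u:x\to y$, $i\ge1$, has a $\ast^i_{i-1}$-inverse. Morphisms are the maps of globular sets preserving compositions and identities. $L$ denotes the left adjoint of the forgetful functor from strict $\infty$-groupoids to globular sets. Globular sums. A table of dimensions $T$ consists of integers $i_1,\dots,i_k\ge0$ and $i'_1,\dots,i'_{k-1}\ge0$ ($k\ge1$) with $i_l>i'_l<i_{l+1}$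 for $1\le l\le k-1$. $G_T$ is the colimit in globular sets of the zigzag diagram $D_{i_1}\leftarrow D_{i'_1}\to D_{i_2}\leftarrow\cdots\leftarrow D_{i'_{k-1}}\to D_{i_k}$ whose maps are $\sigma^{i_l}_{i'_l}:D_{i'_l}\to D_{i_l}$ and $\tau^{i_{l+1}}_{i'_l}:D_{i'_l}\to D_{i_{l+1}}$. These $G_T$ are the globular pasting schemes. The category $\widetilde\Theta$ has the tables of dimensions as objects, with $\mathrm{Hom}_{\widetilde\Theta}(S,T)=\mathrm{Hom}(L(G_S),L(G_T))$ (morphisms of strict $\infty$-groupoids). Weak contractibility. In a strict $\infty$-groupoid $G$, write $u\sim v$ for $n$-arrows $u,v$ if there is an $(n+1)$-arrow from $u$ to $v$; this is an equivalence relation. Put $\pi_0(G)=G_0/{\sim}$ and, for $n\ge1$ and $x\in G_0$, let $\pi_n(G,x)$ be the group (under $\ast^n_{n-1}$) of $n$-arrows from $k^{n-1}_0(x)$ to itself modulo $\sim$, where $k^{n-1}_0(x)$ is the $(n-1)$-dimensional iterated identity of $x$. $G$ is weakly contractible if $\pi_0(G)$ is a one-element set and $\pi_n(G,x)$ is trivial for all $n\ge1$ and all objects $x$. *)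

(* Defs.v *)
From mathcomp Require Import all_boot.
From mathcomp Require Import boolp.

Set Implicit Arguments.
Unset Strict Implicit.
Unset Printing Implicit Defensive.

(* [ltT j i] is [j < i] as a type with at most one element (see [ltT_irr] and
   [ltTP] below).  Recursion on it computes iterated sources, targets and
   identities with no transport along equalities between natural numbers. *)
Inductive ltT (j : nat) : nat -> Type :=
| ltT_base : ltT j j.+1
| ltT_S i : ltT j i -> ltT j i.+1.

Arguments ltT_base {j}.
Arguments ltT_S {j i} _.

Fixpoint ltT_trans k j i (q : ltT k j) (p : ltT j i) : ltT k i :=
  match p with
  | ltT_base => ltT_S q
  | ltT_S _ p' => ltT_S (ltT_trans q p')
  end.

Fixpoint ltT_pred j i (p : ltT j.+1 i) : ltT j i :=
  match p with
  | ltT_base => ltT_S ltT_base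
  | ltT_S _ p' => ltT_S (ltT_pred p')
  end.

Lemma ltT_lt j i : ltT j i -> j < i.
Proof. by elim=> // {}i _ /leqW. Qed.

Fixpoint ltT_of j i : j < i -> ltT j i :=
  match i return j < i -> ltT j i with
  | 0 => fun h => False_rect _ (notF h)
  | i'.+1 => fun h =>
      match eqVneq j i' with
      | EqNotNeq e => eq_rect j (fun m => ltT j m.+1) ltT_base i' e
      | NeqNotEq ne =>
          ltT_S (@ltT_of j i' (etrans (ltn_neqAle j i') (introT andP (conj ne h))))
      end
  end.

Lemma ltTP j i : inhabited (ltT j i) <-> j < i.
Proof. by split=> [[]|/ltT_of p]; [exact: ltT_lt|exact: inhabits p]. Qed.

Lemma ltT_irr j i (p q : ltT j i) : p = q.
Proof.
elim: p q => [|{}i p IH] q.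
- suff H m (r : ltT j m) (e : m = j.+1) :
      eq_rect m (ltT j) r _ e = ltT_base by rewrite -(H _ q erefl).
  case: m / r e => [|m r] e; first by rewrite (eq_irrelevance e erefl).
  by exfalso; move: (ltT_lt r); case: e => ->; rewrite ltnn.
- suff H m (r : ltT j m) (e : m = i.+1) :
      eq_rect m (ltT j) r _ e = ltT_S p by rewrite -(H _ q erefl).
  case: m / r e => [|m r] e.
    by exfalso; move: (ltT_lt p); case: e => ->; rewrite ltnn.
  case: (e) => e'; subst m; rewrite (eq_irrelevance e erefl) /=.
  by rewrite (IH r).
Qed.

Record globset := Globset {
  cell :> nat -> Type;
  src : forall i, cell i.+1 -> cell i;
  tgt : forall i, cell i.+1 -> cell i;
  src_glob : forall i (x : cell i.+2), src (src x) = src (tgt x);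
  tgt_glob : forall i (x : cell i.+2), tgt (src x) = tgt (tgt x) }.

Arguments src {_ i} _.
Arguments tgt {_ i} _.

Fixpoint isrc (G : globset) j i (p : ltT j i) : G i -> G j :=
  match p in ltT _ i return G i -> G j with
  | ltT_base => fun x => src x
  | ltT_S _ p' => fun x => isrc p' (src x)
  end.

Fixpoint itgt (G : globset) j i (p : ltT j i) : G i -> G j :=
  match p in ltT _ i return G i -> G j with
  | ltT_base => fun x => tgt x
  | ltT_S _ p' => fun x => itgt p' (tgt x)
  end.

Record gmap (X Y : globset) := Gmap {
  gfun :> forall i, X i -> Y i;
  gfun_src : forall i (x : X i.+1), gfun (src x) = src (gfun x);
  gfun_tgt : forall i (x : X i.+1), gfun (tgt x) = tgt (gfun x) }.

Arguments gfun {X Y} _ i _.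

Lemma gmap_ext X Y (f g : gmap X Y) : (forall i (x : X i), f i x = g i x) -> f = g.
Proof.
case: f g => [f fs ft] [g gs gt] /= E.
have e : f = g by apply: functional_extensionality_dep => i; apply: funext => x.
by subst g; congr Gmap; exact: Prop_irrelevance.
Qed.

Definition gmap_id X : gmap X X :=
  @Gmap X X (fun _ x => x) (fun _ _ => erefl) (fun _ _ => erefl).

Program Definition gmap_comp X Y Z (g : gmap Y Z) (f : gmap X Y) : gmap X Z :=
  @Gmap X Z (fun i x => g i (f i x)) _ _.
Next Obligation. by rewrite !gfun_src. Qed.
Next Obligation. by rewrite !gfun_tgt. Qed.

Lemma gfun_isrc X Y (f : gmap X Y) j i (p : ltT j i) (x : X i) :
  f j (isrc p x) = isrc p (f i x).
Proof. by elim: p x => [|{}i p IH] x /=; rewrite ?IH gfun_src. Qed.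

Lemma gfun_itgt X Y (f : gmap X Y) j i (p : ltT j i) (x : X i) :
  f j (itgt p x) = itgt p (f i x).
Proof. by elim: p x => [|{}i p IH] x /=; rewrite ?IH gfun_tgt. Qed.

(* Normal forms of the arrows D_j -> D_i: the identity, and for j < i the two
   arrows sigma^i_j ([true]) and tau^i_j ([false]); by the relations, a composite
   of generators only depends on its first factor and on its domain and codomain. *)
Inductive ghom (j : nat) : nat -> Type :=
| ghom_id : ghom j j
| ghom_face i : bool -> ltT j i -> ghom j i.

Arguments ghom_id {j}.
Arguments ghom_face {j i} _ _.

(* Precomposition with sigma_{j+1} ([b = true]) or tau_{j+1} ([b = false]). *)
Definition ghom_pre (b : bool) j i (f : ghom j.+1 i) : ghom j i :=
  match f in ghom _ i return ghom j i with
  | ghom_id => ghom_face b ltT_base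
  | ghom_face _ _ p => ghom_face b (ltT_pred p)
  end.

Definition ghom_comp k j i (g : ghom j i) : ghom k j -> ghom k i :=
  match g in ghom _ i return ghom k j -> ghom k i with
  | ghom_id => fun f => f
  | ghom_face i c p => fun f =>
      match f in ghom _ j return ltT j i -> ghom k i with
      | ghom_id => fun p => ghom_face c p
      | ghom_face _ b q => fun p => ghom_face b (ltT_trans q p)
      end p
  end.

Program Definition globe (n : nat) : globset :=
  @Globset (fun j => ghom j n) (fun j => @ghom_pre true j n)
    (fun j => @ghom_pre false j n) _ _.
Next Obligation. by case: x. Qed.
Next Obligation. by case: x. Qed.

Lemma ghom_pre_comp b k j i (g : ghom j i) (f : ghom k.+1 j) :
  ghom_comp g (ghom_pre b f) = ghom_pre b (ghom_comp g f).
Proof.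
case: g => [|m c p] //=; case: j / f p => [|j d q] p /=;
  by congr ghom_face; exact: ltT_irr.
Qed.

Definition globe_map j i (g : ghom j i) : gmap (globe j) (globe i) :=
  @Gmap (globe j) (globe i) (fun k f => ghom_comp g f)
    (fun k f => ghom_pre_comp true g f) (fun k f => ghom_pre_comp false g f).

Definition sigma j i (p : ltT j i) := globe_map (ghom_face true p).
Definition tau j i (p : ltT j i) := globe_map (ghom_face false p).

Lemma isrc_pred (X : globset) j i (p : ltT j.+1 i) (x : X i) :
  isrc (ltT_pred p) x = src (isrc p x) /\
  itgt (ltT_pred p) x = tgt (itgt p x).
Proof. by elim: p x => [|{}i p IH] x //=; split; have [] := IH (src x); have [] := IH (tgt x). Qed.

Lemma isrc_glob (X : globset) j i (p : ltT j.+1 i) (x : X i) :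
  src (isrc p x) = src (itgt p x) /\ tgt (isrc p x) = tgt (itgt p x).
Proof.
have H m (q : ltT j.+1 m) (y : X m.+1) : src (isrc q (src y)) = src (isrc q (tgt y))
   /\ tgt (isrc q (src y)) = tgt (isrc q (tgt y)).
  by case: m / q y => [|m q] y /=; rewrite (src_glob y).
elim: p x => [|{}i p IH] x /=; first by rewrite src_glob tgt_glob.
by have [-> ->] := H _ p x; have [-> ->] := IH (tgt x).
Qed.

Lemma globe_isrc n j i (p : ltT j i) (f : globe n i) :
  isrc p f = ghom_comp f (ghom_face true p).
Proof.
elim: p f => [|{}i p IH] f /=; last rewrite {}IH; case: n / f => [|n c q] //=;
  by congr ghom_face; exact: ltT_irr.
Qed.

Lemma globe_itgt n j i (p : ltT j i) (f : globe n i) :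
  itgt p f = ghom_comp f (ghom_face false p).
Proof.
elim: p f => [|{}i p IH] f /=; last rewrite {}IH; case: n / f => [|n c q] //=;
  by congr ghom_face; exact: ltT_irr.
Qed.

Lemma isrc_globS (X : globset) j i (p : ltT j i) (x : X i.+1) :
  isrc p (src x) = isrc p (tgt x).
Proof. by case: i / p x => [|i p] x /=; rewrite (src_glob x). Qed.

Lemma itgt_globS (X : globset) j i (p : ltT j i) (x : X i.+1) :
  itgt p (src x) = itgt p (tgt x).
Proof. by case: i / p x => [|i p] x /=; rewrite (tgt_glob x). Qed.

Lemma isrc_trans (X : globset) k j i (q : ltT k j) (p : ltT j i) (x : X i) :
  isrc (ltT_trans q p) x = isrc q (isrc p x).
Proof. by elim: p x => [|{}i p IH] x //=. Qed.

Lemma itgt_trans (X : globset) k j i (q : ltT k j) (p : ltT j i) (x : X i) :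
  itgt (ltT_trans q p) x = itgt q (itgt p x).
Proof. by elim: p x => [|{}i p IH] x //=. Qed.

Lemma isrc_iglob (X : globset) k j i (q : ltT k j) (p : ltT j i) (x : X i) :
  isrc q (isrc p x) = isrc q (itgt p x).
Proof.
elim: p q x => [|{}i p IH] q x /=; first exact: isrc_globS.
by rewrite IH itgt_globS.
Qed.

Lemma itgt_iglob (X : globset) k j i (q : ltT k j) (p : ltT j i) (x : X i) :
  itgt q (isrc p x) = itgt q (itgt p x).
Proof.
elim: p q x => [|{}i p IH] q x /=; first exact: itgt_globS.
by rewrite IH itgt_globS.
Qed.

(* [globe n] represents X |-> X_n, naturally in X. *)
Theorem yoneda (X : globset) n (x : X n) :
  exists! f : gmap (globe n) X, f n ghom_id = x.
Proof.
pose F j (f : ghom j n) : X j :=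
  match f in ghom _ n return X n -> X j with
  | ghom_id => fun x => x
  | ghom_face _ b p => fun x => if b then isrc p x else itgt p x
  end x.
have Fs j (f : ghom j.+1 n) : F j (ghom_pre true f) = src (F _ f).
  rewrite /F; case: n / f x {F} => [|m b p] x //=.
  by rewrite (isrc_pred p x).1; case: b => //; rewrite (isrc_glob p x).1.
have Ft j (f : ghom j.+1 n) : F j (ghom_pre false f) = tgt (F _ f).
  rewrite /F; case: n / f x {F Fs} => [|m b p] x //=.
  by rewrite (isrc_pred p x).2; case: b => //; rewrite (isrc_glob p x).2.
exists (@Gmap (globe n) X F Fs Ft); split=> // g gx.
apply: gmap_ext => j f /=; rewrite /F.
case: n / f x g gx {F Fs Ft} => [|m b p] x g <- //=.
case: b.
- rewrite -gfun_isrc; congr (g _ _); exact: globe_isrc.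
- rewrite -gfun_itgt; congr (g _ _); exact: globe_itgt.
Qed.

Definition composable (G : globset) j i (p : ltT j i) (u v : G i) : Prop :=
  isrc p u = itgt p v.

Fixpoint iident (G : globset) (k : forall i, G i -> G i.+1) j i (p : ltT j i) :
    G j -> G i :=
  match p in ltT _ i return G j -> G i with
  | ltT_base => fun x => k j x
  | ltT_S _ p' => fun x => k _ (iident k p' x)
  end.

(* [comp p u v] is the composite u *^i_j v.  It is total for convenience only:
   its values on non-composable pairs are subject to no axiom, and need not be
   preserved by morphisms. *)
Record infcat := Infcat {
  underlying :> globset;
  comp : forall j i, ltT j i -> underlying i -> underlying i -> underlying i;
  ident : forall i, underlying i -> underlying i.+1;
  src_comp_base : forall i (u v : underlying i.+1),
    composable ltT_base u v -> src (comp ltT_base u v) = src v;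
  tgt_comp_base : forall i (u v : underlying i.+1),
    composable ltT_base u v -> tgt (comp ltT_base u v) = tgt u;
  src_comp_S : forall j i (p : ltT j i) (u v : underlying i.+1),
    composable (ltT_S p) u v ->
    src (comp (ltT_S p) u v) = comp p (src u) (src v);
  tgt_comp_S : forall j i (p : ltT j i) (u v : underlying i.+1),
    composable (ltT_S p) u v ->
    tgt (comp (ltT_S p) u v) = comp p (tgt u) (tgt v);
  src_ident : forall i (u : underlying i), src (ident u) = u;
  tgt_ident : forall i (u : underlying i), tgt (ident u) = u;
  compA : forall j i (p : ltT j i) (u v w : underlying i),
    composable p u v -> composable p v w ->
    comp p (comp p u v) w = comp p u (comp p v w);
  exchange : forall k j i (q : ltT k j) (p : ltT j i) (u u' v v' : underlying i),
    composable p u u' -> composable p v v' ->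
    composable (ltT_trans q p) u v -> composable (ltT_trans q p) u' v' ->
    comp (ltT_trans q p) (comp p u u') (comp p v v') =
    comp p (comp (ltT_trans q p) u v) (comp (ltT_trans q p) u' v');
  comp_identl : forall j i (p : ltT j i) (u : underlying i),
    comp p (iident ident p (itgt p u)) u = u;
  comp_identr : forall j i (p : ltT j i) (u : underlying i),
    comp p u (iident ident p (isrc p u)) = u;
  ident_comp : forall j i (p : ltT j i) (u v : underlying i),
    composable p u v ->
    ident (comp p u v) = comp (ltT_S p) (ident u) (ident v) }.

Arguments comp {_ j i} _ _ _.
Arguments ident {_ i} _.

Lemma composable_faces (G : globset) j i (p : ltT j i) (u v : G i.+1) :
  composable (ltT_S p) u v -> composable p (src u) (src v) /\ composable p (tgt u) (tgt v).
Proof.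
by rewrite /composable /= => h; split; [rewrite h itgt_globS|rewrite -isrc_globS h].
Qed.

Lemma isrc_comp (G : infcat) j i (p : ltT j i) (u v : G i) :
  composable p u v -> isrc p (comp p u v) = isrc p v.
Proof.
elim: p u v => [|{}i p IH] u v h /=; first by rewrite src_comp_base.
by rewrite src_comp_S // IH //; have [] := composable_faces h.
Qed.

Lemma itgt_comp (G : infcat) j i (p : ltT j i) (u v : G i) :
  composable p u v -> itgt p (comp p u v) = itgt p u.
Proof.
elim: p u v => [|{}i p IH] u v h /=; first by rewrite tgt_comp_base.
by rewrite tgt_comp_S // IH //; have [] := composable_faces h.
Qed.

Lemma isrc_comp_trans (G : infcat) k j i (q : ltT k j) (p : ltT j i) (u v : G i) :
  composable (ltT_trans q p) u v ->
  isrc p (comp (ltT_trans q p) u v) = comp q (isrc p u) (isrc p v).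
Proof.
elim: p u v => [|{}i p IH] u v h /=; first by rewrite src_comp_S.
by rewrite src_comp_S // IH //; have [] := composable_faces h.
Qed.

Lemma itgt_comp_trans (G : infcat) k j i (q : ltT k j) (p : ltT j i) (u v : G i) :
  composable (ltT_trans q p) u v ->
  itgt p (comp (ltT_trans q p) u v) = comp q (itgt p u) (itgt p v).
Proof.
elim: p u v => [|{}i p IH] u v h /=; first by rewrite tgt_comp_S.
by rewrite tgt_comp_S // IH //; have [] := composable_faces h.
Qed.

Lemma composable_exchange (G : infcat) k j i (q : ltT k j) (p : ltT j i)
    (u u' v v' : G i) :
  composable p u u' -> composable p v v' ->
  composable (ltT_trans q p) u v -> composable (ltT_trans q p) u' v' ->
  composable (ltT_trans q p) (comp p u u') (comp p v v') /\
  composable p (comp (ltT_trans q p) u v) (comp (ltT_trans q p) u' v').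
Proof.
move=> uu vv uv uv'; split; rewrite /composable.
  rewrite isrc_trans isrc_comp // itgt_trans itgt_comp // -isrc_trans.
  by rewrite -itgt_iglob vv uv' itgt_trans.
by rewrite isrc_comp_trans // itgt_comp_trans // uu vv.
Qed.

Lemma isrc_iident (G : infcat) j i (p : ltT j i) (u : G j) :
  isrc p (iident (@ident G) p u) = u.
Proof. by elim: p => [|{}i p IH] /=; rewrite src_ident. Qed.

Lemma itgt_iident (G : infcat) j i (p : ltT j i) (u : G j) :
  itgt p (iident (@ident G) p u) = u.
Proof. by elim: p => [|{}i p IH] /=; rewrite tgt_ident. Qed.

Definition is_inverse (G : infcat) i (u v : G i.+1) : Prop :=
  [/\ src v = tgt u, tgt v = src u,
      comp ltT_base u v = ident (tgt u) & comp ltT_base v u = ident (src u)].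

Record infgpd := Infgpd {
  gpd_cat :> infcat;
  gpd_inv : forall i (u : gpd_cat i.+1), exists v, is_inverse u v }.

Record gpdmap (G H : infgpd) := Gpdmap {
  gpd_gmap :> gmap G H;
  gpdmap_comp : forall j i (p : ltT j i) (u v : G i), composable p u v ->
    gpd_gmap i (comp p u v) = comp p (gpd_gmap i u) (gpd_gmap i v);
  gpdmap_ident : forall i (u : G i), gpd_gmap i.+1 (ident u) = ident (gpd_gmap i u) }.

Lemma gpdmap_ext G H (f g : gpdmap G H) :
  (forall i (x : G i), f i x = g i x) -> f = g.
Proof.
case: f g => [f fc fi] [g gc gi] /= E.
have e : f = g by apply: gmap_ext.
by subst g; congr Gpdmap; exact: Prop_irrelevance.
Qed.

Definition gpdmap_id G : gpdmap G G :=
  @Gpdmap G G (gmap_id G) (fun _ _ _ _ _ _ => erefl) (fun _ _ => erefl).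

Lemma gpdmap_composable G H (f : gmap G H) j i (p : ltT j i) (u v : G i) :
  composable p u v -> composable p (f i u) (f i v).
Proof. by rewrite /composable -gfun_isrc -gfun_itgt => ->. Qed.

Program Definition gpdmap_o G H K (g : gpdmap H K) (f : gpdmap G H) : gpdmap G K :=
  @Gpdmap G K (gmap_comp g f) _ _.
Next Obligation.
by rewrite gpdmap_comp // gpdmap_comp //; exact: gpdmap_composable.
Qed.
Next Obligation. by rewrite !gpdmap_ident. Qed.

(* A left adjoint of the forgetful functor from strict infinity-groupoids to
   globular sets; the latter is given by the coercions from [infgpd] to [globset]
   and from [gpdmap] to [gmap]. *)
Record left_adjoint := LeftAdjoint {
  free :> globset -> infgpd;
  free_map : forall X Y, gmap X Y -> gpdmap (free X) (free Y);
  free_map_id : forall X, free_map (gmap_id X) = gpdmap_id (free X);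
  free_map_comp : forall X Y Z (g : gmap Y Z) (f : gmap X Y),
    free_map (gmap_comp g f) = gpdmap_o (free_map g) (free_map f);
  transpose : forall X (G : infgpd), gpdmap (free X) G -> gmap X G;
  transpose_bij : forall X G, bijective (@transpose X G);
  transpose_natl : forall X Y G (f : gmap X Y) (g : gpdmap (free Y) G),
    transpose (gpdmap_o g (free_map f)) = gmap_comp (transpose g) f;
  transpose_natr : forall X G H (h : gpdmap G H) (g : gpdmap (free X) G),
    transpose (gpdmap_o h g) = gmap_comp h (transpose g) }.

(* With k = width + 1, [dims] lists i_1, ..., i_k and [cuts] lists
   i'_1, ..., i'_(k-1). *)
Record table := Table {
  width : nat;
  dims : 'I_width.+1 -> nat;
  cuts : 'I_width -> nat;
  cuts_ltl : forall l : 'I_width, cuts l < dims (widen_ord (leqnSn width) l);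
  cuts_ltr : forall l : 'I_width, cuts l < dims (lift ord0 l) }.

Section GlobularSums.

Variable T : table.

Definition left_leg (l : 'I_(width T)) :
    gmap (globe (cuts l)) (globe (dims (widen_ord (leqnSn (width T)) l))) :=
  sigma (ltT_of (cuts_ltl l)).

Definition right_leg (l : 'I_(width T)) :
    gmap (globe (cuts l)) (globe (dims (lift ord0 l))) :=
  tau (ltT_of (cuts_ltr l)).

(* A cocone under the zigzag; the components at the D_{i'_l} are determined by those at the D_{i_l}. *)
Record cocone (X : globset) := Cocone {
  coproj : forall l : 'I_(width T).+1, gmap (globe (dims l)) X;
  coproj_glue : forall l : 'I_(width T),
    gmap_comp (coproj (widen_ord (leqnSn (width T)) l)) (left_leg l) =
    gmap_comp (coproj (lift ord0 l)) (right_leg l) }.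

Definition is_globular_sum (X : globset) (c : cocone X) : Prop :=
  forall (Y : globset) (d : cocone Y),
    exists! f : gmap X Y, forall l, gmap_comp f (coproj c l) = coproj d l.

End GlobularSums.

Section Quotient.

Variables (A : Type) (R : A -> A -> Prop).

Definition quot := {P : A -> Prop | exists a, P = R a}.

Definition cls (a : A) : quot := exist _ (R a) (ex_intro _ a erefl).

Definition repr (c : quot) : A := sval (cid (svalP c)).

Hypotheses (Rrefl : forall a, R a a) (Rsym : forall a b, R a b -> R b a)
  (Rtrans : forall a b c, R a b -> R b c -> R a c).

Lemma clsP a b : cls a = cls b <-> R a b.
Proof.
split=> [[E]|Rab]; first by rewrite E.
apply: eq_exist; apply: funext => c; apply: propext.
by split; apply: Rtrans => //; exact: Rsym.
Qed.

Lemma reprK (c : quot) : cls (repr c) = c.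
Proof.
by case: c => P h; apply: eq_exist; rewrite /repr; case: cid.
Qed.

Lemma repr_cls a : R (repr (cls a)) a.
Proof. by apply/clsP; rewrite reprK. Qed.

End Quotient.

Definition sim (G : globset) n (u v : G n) : Prop :=
  exists w : G n.+1, src w = u /\ tgt w = v.

Fixpoint idn (G : infcat) n (x : G 0) : G n :=
  match n with
  | 0 => x
  | n'.+1 => ident (idn n' x)
  end.

Definition pi0 (G : infgpd) : Type := quot (@sim G 0).

(* The (n+1)-arrows from the n-dimensional identity of [x] to itself. *)
Record loop (G : infcat) n (x : G 0) := Loop {
  loop_arrow :> G n.+1;
  loop_src : src loop_arrow = idn n x;
  loop_tgt : tgt loop_arrow = idn n x }.

Definition loop_sim (G : infcat) n (x : G 0) (u v : loop n x) : Prop :=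
  sim (loop_arrow u) (loop_arrow v).

(* The underlying set of pi_{n+1}(G, x). *)
Definition piS (G : infgpd) n (x : G 0) : Type := quot (@loop_sim G n x).

Program Definition loop_one (G : infcat) n (x : G 0) : loop n x :=
  @Loop G n x (ident (idn n x)) _ _.
Next Obligation. by rewrite src_ident. Qed.
Next Obligation. by rewrite tgt_ident. Qed.

Lemma loop_composable (G : infcat) n (x : G 0) (u v : loop n x) :
  composable ltT_base (loop_arrow u) (loop_arrow v).
Proof. by rewrite /composable /= loop_src loop_tgt. Qed.

Program Definition loop_mul (G : infcat) n (x : G 0) (u v : loop n x) : loop n x :=
  @Loop G n x (comp ltT_base u v) _ _.
Next Obligation. by rewrite src_comp_base ?loop_src //; exact: loop_composable. Qed.
Next Obligation. by rewrite tgt_comp_base ?loop_tgt //; exact: loop_composable. Qed.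

Definition piS_one (G : infgpd) n (x : G 0) : piS n x := cls _ (loop_one n x).

Definition piS_mul (G : infgpd) n (x : G 0) (a b : piS n x) : piS n x :=
  cls _ (loop_mul (repr a) (repr b)).

Definition weakly_contractible (G : infgpd) : Prop :=
  (exists a : pi0 G, forall b : pi0 G, b = a) /\
  (forall n (x : G 0) (a : piS n x), a = piS_one n x).

Section HomotopyGroups.

Variable G : infgpd.

Lemma sim_refl n (u : G n) : sim u u.
Proof. by exists (ident u); rewrite src_ident tgt_ident. Qed.

Lemma sim_sym n (u v : G n) : sim u v -> sim v u.
Proof. by case=> w [<- <-]; have [w' [? ? _ _]] := gpd_inv w; exists w'. Qed.

Lemma sim_trans n (u v w : G n) : sim u v -> sim v w -> sim u w.
Proof.
case=> a [<- av] [b [bv <-]]; have ba : composable ltT_base b a by rewrite /composable /= av.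
by exists (comp ltT_base b a); rewrite src_comp_base // tgt_comp_base.
Qed.

Lemma pi0P (x y : G 0) : cls (@sim G 0) x = cls _ y <-> sim x y.
Proof. by apply: clsP; [exact: sim_refl|exact: sim_sym|exact: sim_trans]. Qed.

Section LoopGroups.

Variables (n : nat) (x : G 0).

Lemma piSP (u v : loop n x) : cls (@loop_sim G n x) u = cls _ v <-> sim (u : G _) v.
Proof.
apply: clsP => [a|a b|a b c]; [exact: sim_refl|exact: sim_sym|exact: sim_trans].
Qed.

Lemma loop_ext (u v : loop n x) : u = v :> G n.+1 -> u = v.
Proof.
case: u v => [u us ut] [v vs vt] /= e; subst v.
by congr Loop; exact: Prop_irrelevance.
Qed.

Lemma piS_mul_cls (u v : loop n x) :
  piS_mul (cls _ u) (cls _ v) = cls _ (loop_mul u v).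
Proof.
have [w [ws wt]] : sim (repr (cls (@loop_sim G n x) u) : G _) u.
  by apply/piSP; rewrite reprK.
have [z [zs zt]] : sim (repr (cls (@loop_sim G n x) v) : G _) v.
  by apply/piSP; rewrite reprK.
have wz : composable (ltT_S ltT_base) w z.
  by rewrite /composable /= ws -tgt_glob zs loop_src loop_tgt.
apply/piSP; exists (comp (ltT_S ltT_base) w z).
by rewrite src_comp_S // tgt_comp_S // ws wt zs zt.
Qed.

Lemma piS_mulA : associative (@piS_mul G n x).
Proof.
move=> a b c; rewrite -(reprK a) -(reprK b) -(reprK c) !piS_mul_cls.
by congr cls; apply: loop_ext; rewrite /= compA //; exact: loop_composable.
Qed.

Lemma piS_mul1 : left_id (piS_one n x) (@piS_mul G n x).
Proof.
move=> a; rewrite -(reprK a) piS_mul_cls; congr cls; apply: loop_ext => /=.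
by have := comp_identl ltT_base (repr a : G _); rewrite /= loop_tgt.
Qed.

Lemma piS_inv (a : piS n x) : exists b, piS_mul b a = piS_one n x.
Proof.
rewrite -(reprK a); have [v [vs vt _ e]] := gpd_inv (repr a : G _).
rewrite loop_tgt in vs; rewrite loop_src in vt e.
exists (cls _ (Loop vs vt)); rewrite piS_mul_cls; congr cls; exact: loop_ext.
Qed.

End LoopGroups.

End HomotopyGroups.

Section GlobularSumExistence.

Variable T : table.

Let pt i := {l : 'I_(width T).+1 & globe (dims l) i}.
Let ev Y (d : cocone T Y) i (a : pt i) : Y i := coproj d (tag a) i (tagged a).
Let rel i (a b : pt i) := forall Y (d : cocone T Y), ev d a = ev d b.

Let relP i a b : cls (@rel i) a = cls _ b <-> rel a b.
Proof. by apply: clsP => // [p q h Y d|p q r h h' Y d]; rewrite ?h ?h'. Qed.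

Let lift_src i (a : quot (@rel i.+1)) : quot (@rel i) :=
  cls _ (Tagged (fun l => globe (dims l) i) (src (tagged (repr a)))).
Let lift_tgt i (a : quot (@rel i.+1)) : quot (@rel i) :=
  cls _ (Tagged (fun l => globe (dims l) i) (tgt (tagged (repr a)))).

Let qev Y (d : cocone T Y) i (a : quot (@rel i)) : Y i := ev d (repr a).

Let qev_cls Y (d : cocone T Y) i (a : pt i) : qev d (cls _ a) = ev d a.
Proof. exact: ((relP _ _).1 (reprK (cls (@rel i) a))). Qed.

Let qev_ext i (a b : quot (@rel i)) :
  (forall Y (d : cocone T Y), qev d a = qev d b) -> a = b.
Proof. by move=> H; rewrite -(reprK a) -(reprK b); apply/relP. Qed.

Let qev_src Y (d : cocone T Y) i (a : quot (@rel i.+1)) :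
  qev d (lift_src a) = src (qev d a).
Proof. by rewrite qev_cls /ev /= gfun_src. Qed.

Let qev_tgt Y (d : cocone T Y) i (a : quot (@rel i.+1)) :
  qev d (lift_tgt a) = tgt (qev d a).
Proof. by rewrite qev_cls /ev /= gfun_tgt. Qed.

Theorem globular_sum_exists :
  exists (X : globset) (c : cocone T X), is_globular_sum c.
Proof.
have ss i (a : quot (@rel i.+2)) : lift_src (lift_src a) = lift_src (lift_tgt a).
  by apply: qev_ext => Y d; rewrite !(qev_src, qev_tgt) src_glob.
have tt i (a : quot (@rel i.+2)) : lift_tgt (lift_src a) = lift_tgt (lift_tgt a).
  by apply: qev_ext => Y d; rewrite !(qev_src, qev_tgt) tgt_glob.
pose X := Globset ss tt.
pose inj l i (x : globe (dims l) i) : X i :=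
  cls (@rel i) (Tagged (fun l => globe (dims l) i) x).
have injs l i (x : globe (dims l) i.+1) : inj l i (src x) = src (inj l _ x).
  by apply: qev_ext => Y d; rewrite qev_src !qev_cls /ev /= gfun_src.
have injt l i (x : globe (dims l) i.+1) : inj l i (tgt x) = tgt (inj l _ x).
  by apply: qev_ext => Y d; rewrite qev_tgt !qev_cls /ev /= gfun_tgt.
pose c0 l : gmap (globe (dims l)) X := Gmap (@injs l) (@injt l).
have glue l : gmap_comp (c0 (widen_ord (leqnSn (width T)) l)) (left_leg l) =
    gmap_comp (c0 (lift ord0 l)) (right_leg l).
  apply: gmap_ext => i x; apply: qev_ext => Y d; rewrite !qev_cls /ev.
  by have /(congr1 (fun f : gmap _ _ => f i x)) := coproj_glue d l.
exists X, (Cocone glue) => Y d.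
have fs i (a : X i.+1) : qev d (src a : quot (@rel i)) = src (qev d a).
  exact: qev_src.
have ft i (a : X i.+1) : qev d (tgt a : quot (@rel i)) = tgt (qev d a).
  exact: qev_tgt.
exists (@Gmap X Y (@qev Y d) fs ft); split=> [l|g gd].
  by apply: gmap_ext => i x; exact: qev_cls.
apply: gmap_ext => i a /=; rewrite -(reprK a) qev_cls /ev -gd /=.
by congr (g i (cls _ _)); case: (repr a).
Qed.

End GlobularSumExistence.

Section FreeExistence.

Let inv (G : infgpd) i (u : G i.+1) : G i.+1 := sval (cid (gpd_inv u)).

Let invP (G : infgpd) i (u : G i.+1) : is_inverse u (inv u).
Proof. by rewrite /inv; case: cid. Qed.

Let inv_uniq (G : infgpd) i (u v : G i.+1) : is_inverse u v -> v = inv u.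
Proof.
case=> vs vt e1 e2; have [ws wt e3 e4] := invP u; set w := inv u in ws wt e3 e4 *.
have <- := comp_identr ltT_base v; rewrite /= vs -e3 -compA //.
by rewrite e2 -wt; have /= -> := comp_identl ltT_base w.
Qed.

Let gpdmap_inverse (G H : infgpd) (f : gpdmap G H) i (u v : G i.+1) :
  is_inverse u v -> is_inverse (f i.+1 u) (f i.+1 v).
Proof.
case=> vs vt e1 e2; split; rewrite -?gfun_src -?gfun_tgt ?vs ?vt //.
- by rewrite -gpdmap_comp // e1 gpdmap_ident.
- by rewrite -gpdmap_comp // e2 gpdmap_ident.
Qed.

Variable X : globset.

Inductive term : nat -> Type :=
| Gen i : X i -> term i
| Comp j i : ltT j i -> term i -> term i -> term i
| Ident i : term i -> term i.+1
| Inv i : term i.+1 -> term i.+1.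

Fixpoint eval (G : infgpd) (f : gmap X G) i (t : term i) : G i :=
  match t in term i return G i with
  | Gen i x => f i x
  | Comp _ _ p t1 t2 => comp p (eval f t1) (eval f t2)
  | Ident _ t1 => ident (eval f t1)
  | Inv _ t1 => inv (eval f t1)
  end.

Inductive valid : forall i, term i -> Prop :=
| valid_gen i (x : X i) : valid (Gen x)
| valid_comp j i (p : ltT j i) (t1 t2 : term i) : valid t1 -> valid t2 ->
    (forall (G : infgpd) (f : gmap X G), composable p (eval f t1) (eval f t2)) ->
    valid (Comp p t1 t2)
| valid_ident i (t : term i) : valid t -> valid (Ident t)
| valid_inv i (t : term i.+1) : valid t -> valid (Inv t).

Let vterm i := {t : term i | valid t}.
Let rel i (a b : vterm i) :=
  forall (G : infgpd) (f : gmap X G), eval f (sval a) = eval f (sval b).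
Let fcell i := quot (@rel i).
Let fev (G : infgpd) (f : gmap X G) i (a : fcell i) : G i := eval f (sval (repr a)).

Let relP i a b : cls (@rel i) a = cls _ b <-> rel a b.
Proof. by apply: clsP => // [p q h Y d|p q r h h' Y d]; rewrite ?h ?h'. Qed.

Let fev_ext i (a b : fcell i) :
  (forall (G : infgpd) (f : gmap X G), fev f a = fev f b) -> a = b.
Proof. by move=> H; rewrite -(reprK a) -(reprK b); apply/relP. Qed.

Let fev_term i (t : term i) : valid t ->
  exists a : fcell i, forall (G : infgpd) (f : gmap X G), fev f a = eval f t.
Proof.
move=> vt; exists (cls _ (exist _ t vt)).
exact: ((relP _ _).1 (reprK (cls (@rel i) (exist _ t vt)))).
Qed.

Let faced i : term i -> Prop :=
  match i with
  | 0 => fun _ => True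
  | i'.+1 => fun t =>
    (exists s : term i', valid s /\
      forall (G : infgpd) (f : gmap X G), eval f s = src (eval f t)) /\
    (exists s : term i', valid s /\
      forall (G : infgpd) (f : gmap X G), eval f s = tgt (eval f t))
  end.

Let valid_faced i (t : term i) : valid t -> faced t.
Proof.
elim=> {i t}.
- case=> // i x; split.
    by exists (Gen (src x)); split=> [|G f]; [constructor|rewrite /= gfun_src].
  by exists (Gen (tgt x)); split=> [|G f]; [constructor|rewrite /= gfun_tgt].
- move=> j i p; case: i / p => [|i p] t1 t2 v1 IH1 v2 IH2 c.
    have [_ [r1 [vr1 er1]]] := IH1; have [[s2 [vs2 es2]] _] := IH2; split.
      by exists s2; split=> // G f; rewrite es2 /= src_comp_base //; exact: c.
    by exists r1; split=> // G f; rewrite er1 /= tgt_comp_base //; exact: c.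
  have [[s1 [vs1 es1]] [r1 [vr1 er1]]] := IH1.
  have [[s2 [vs2 es2]] [r2 [vr2 er2]]] := IH2; split.
    exists (Comp p s1 s2); split=> [|G f].
      constructor=> // G f; have := c G f; rewrite /composable /= es1 es2 => ->.
      by case: (i) / (p) (eval f t2) => [|m q] y /=; rewrite (tgt_glob y).
    by rewrite /= es1 es2 src_comp_S //; exact: c.
  exists (Comp p r1 r2); split=> [|G f].
    constructor=> // G f; have := c G f; rewrite /composable /= er1 er2 => <-.
    by case: (i) / (p) (eval f t1) => [|m q] y /=; rewrite (src_glob y).
  by rewrite /= er1 er2 tgt_comp_S //; exact: c.
- by move=> i t vt _; split; exists t; split=> // G f;
    rewrite /= (src_ident, tgt_ident).
- move=> i t vt [[s [vs es]] [r [vr er]]]; split.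
    by exists r; split=> // G f; rewrite er /=; have [] := invP (eval f t).
  by exists s; split=> // G f; rewrite es /=; have [] := invP (eval f t).
Qed.

Let fev_valid i (a : fcell i) :
  exists2 t : term i, valid t &
    forall (G : infgpd) (f : gmap X G), fev f a = eval f t.
Proof. by exists (sval (repr a)) => //; exact: svalP. Qed.

Let src_ex i (a : fcell i.+1) :
  exists b : fcell i, forall (G : infgpd) (f : gmap X G), fev f b = src (fev f a).
Proof.
have [t /valid_faced [[s [/fev_term [b Eb] Es]] _] Et] := fev_valid a.
by exists b => G f; rewrite Eb Es Et.
Qed.

Let tgt_ex i (a : fcell i.+1) :
  exists b : fcell i, forall (G : infgpd) (f : gmap X G), fev f b = tgt (fev f a).
Proof.
have [t /valid_faced [_ [s [/fev_term [b Eb] Es]]] Et] := fev_valid a.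
by exists b => G f; rewrite Eb Es Et.
Qed.

Let fsrc i (a : fcell i.+1) : fcell i := sval (cid (src_ex a)).
Let ftgt i (a : fcell i.+1) : fcell i := sval (cid (tgt_ex a)).

Let fev_src (G : infgpd) (f : gmap X G) i (a : fcell i.+1) : fev f (fsrc a) = src (fev f a).
Proof. by rewrite /fsrc; case: cid. Qed.

Let fev_tgt (G : infgpd) (f : gmap X G) i (a : fcell i.+1) : fev f (ftgt a) = tgt (fev f a).
Proof. by rewrite /ftgt; case: cid. Qed.

Program Definition free_glob : globset := @Globset fcell fsrc ftgt _ _.
Next Obligation. by apply: fev_ext => G f; rewrite !(fev_src, fev_tgt) src_glob. Qed.
Next Obligation. by apply: fev_ext => G f; rewrite !(fev_src, fev_tgt) tgt_glob. Qed.

Definition free_ev (G : infgpd) (f : gmap X G) : gmap free_glob G :=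
  @Gmap free_glob G (@fev G f) (@fev_src G f) (@fev_tgt G f).

Arguments free_ev : simpl never.
Arguments free_glob : simpl never.

Lemma free_ext i (a b : free_glob i) :
  (forall (G : infgpd) (f : gmap X G), free_ev f i a = free_ev f i b) -> a = b.
Proof. exact: fev_ext. Qed.

Lemma free_composable j i (p : ltT j i) (a b : free_glob i) :
  composable p a b <->
  forall (G : infgpd) (f : gmap X G), composable p (free_ev f i a) (free_ev f i b).
Proof.
split=> [ab G f|H]; first exact: gpdmap_composable.
by apply: free_ext => G f; rewrite gfun_isrc gfun_itgt; exact: H.
Qed.

Lemma free_term i (t : term i) : valid t ->
  exists a : free_glob i, forall (G : infgpd) (f : gmap X G), free_ev f i a = eval f t.
Proof. exact: fev_term. Qed.

Lemma free_valid i (a : free_glob i) :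
  exists2 t : term i, valid t &
    forall (G : infgpd) (f : gmap X G), free_ev f i a = eval f t.
Proof. exact: fev_valid. Qed.

Lemma free_comp_ex j i (p : ltT j i) (a b : free_glob i) :
  exists c : free_glob i, composable p a b ->
    forall (G : infgpd) (f : gmap X G),
      free_ev f i c = comp p (free_ev f i a) (free_ev f i b).
Proof.
have [ab|nab] := pselect (composable p a b); last by exists a.
have [t vt Et] := free_valid a; have [s vs Es] := free_valid b.
have v : valid (Comp p t s).
  by constructor=> // G f; rewrite -Et -Es; exact: gpdmap_composable.
by have [c Ec] := free_term v; exists c => _ G f; rewrite Ec Et Es.
Qed.

Definition free_comp j i (p : ltT j i) (a b : free_glob i) : free_glob i :=
  sval (cid (free_comp_ex p a b)).

Lemma free_ev_comp j i (p : ltT j i) (a b : free_glob i) (G : infgpd) (f : gmap X G) :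
  composable p a b ->
  free_ev f i (free_comp p a b) = comp p (free_ev f i a) (free_ev f i b).
Proof. by move=> ab; rewrite /free_comp; case: cid => c /= ->. Qed.

Lemma free_ident_ex i (a : free_glob i) :
  exists c : free_glob i.+1, forall (G : infgpd) (f : gmap X G),
    free_ev f i.+1 c = ident (free_ev f i a).
Proof.
have [t vt Et] := free_valid a; have [c Ec] := free_term (valid_ident vt).
by exists c => G f; rewrite Ec Et.
Qed.

Definition free_ident i (a : free_glob i) : free_glob i.+1 :=
  sval (cid (free_ident_ex a)).

Lemma free_ev_ident i (a : free_glob i) (G : infgpd) (f : gmap X G) :
  free_ev f i.+1 (free_ident a) = ident (free_ev f i a).
Proof. by rewrite /free_ident; case: cid. Qed.

Lemma free_inv_ex i (a : free_glob i.+1) :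
  exists c : free_glob i.+1, forall (G : infgpd) (f : gmap X G),
    is_inverse (free_ev f i.+1 a) (free_ev f i.+1 c).
Proof.
have [t vt Et] := free_valid a; have [c Ec] := free_term (valid_inv vt).
by exists c => G f; rewrite Ec Et; exact: invP.
Qed.

Lemma free_ev_iident j i (p : ltT j i) (a : free_glob j) (G : infgpd) (f : gmap X G) :
  free_ev f i (iident free_ident p a) = iident (@ident G) p (free_ev f j a).
Proof.
elim: p => [|{}i p IH]; first exact: free_ev_ident.
exact: etrans (free_ev_ident _ _) (congr1 (@ident G i) IH).
Qed.

Lemma free_src_comp_base i (u v : free_glob i.+1) :
  composable ltT_base u v -> src (free_comp ltT_base u v) = src v.
Proof.
move=> h; apply: free_ext => G f; rewrite !gfun_src free_ev_comp //.
by rewrite src_comp_base //; exact: gpdmap_composable.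
Qed.

Lemma free_tgt_comp_base i (u v : free_glob i.+1) :
  composable ltT_base u v -> tgt (free_comp ltT_base u v) = tgt u.
Proof.
move=> h; apply: free_ext => G f; rewrite !gfun_tgt free_ev_comp //.
by rewrite tgt_comp_base //; exact: gpdmap_composable.
Qed.

Lemma free_src_comp_S j i (p : ltT j i) (u v : free_glob i.+1) :
  composable (ltT_S p) u v ->
  src (free_comp (ltT_S p) u v) = free_comp p (src u) (src v).
Proof.
move=> h; have [h' _] := composable_faces h.
apply: free_ext => G f; rewrite !gfun_src !free_ev_comp // src_comp_S ?gfun_src //.
exact: gpdmap_composable.
Qed.

Lemma free_tgt_comp_S j i (p : ltT j i) (u v : free_glob i.+1) :
  composable (ltT_S p) u v ->
  tgt (free_comp (ltT_S p) u v) = free_comp p (tgt u) (tgt v).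
Proof.
move=> h; have [_ h'] := composable_faces h.
apply: free_ext => G f; rewrite !gfun_tgt !free_ev_comp // tgt_comp_S ?gfun_tgt //.
exact: gpdmap_composable.
Qed.

Lemma free_src_ident i (u : free_glob i) : src (free_ident u) = u.
Proof. by apply: free_ext => G f; rewrite gfun_src free_ev_ident src_ident. Qed.

Lemma free_tgt_ident i (u : free_glob i) : tgt (free_ident u) = u.
Proof. by apply: free_ext => G f; rewrite gfun_tgt free_ev_ident tgt_ident. Qed.

Lemma free_compA j i (p : ltT j i) (u v w : free_glob i) :
  composable p u v -> composable p v w ->
  free_comp p (free_comp p u v) w = free_comp p u (free_comp p v w).
Proof.
move=> uv vw; apply: free_ext => G f.
have uv' := gpdmap_composable (free_ev f) uv; have vw' := gpdmap_composable (free_ev f) vw.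
rewrite !free_ev_comp //; first exact: compA.
- apply/free_composable => H g; rewrite /composable free_ev_comp // itgt_comp.
    exact: (gpdmap_composable (free_ev g) uv).
  exact: (gpdmap_composable (free_ev g) vw).
- apply/free_composable => H g; rewrite /composable free_ev_comp // isrc_comp.
    exact: (gpdmap_composable (free_ev g) vw).
  exact: (gpdmap_composable (free_ev g) uv).
Qed.

Lemma free_exchange k j i (q : ltT k j) (p : ltT j i) (u u' v v' : free_glob i) :
  composable p u u' -> composable p v v' ->
  composable (ltT_trans q p) u v -> composable (ltT_trans q p) u' v' ->
  free_comp (ltT_trans q p) (free_comp p u u') (free_comp p v v') =
  free_comp p (free_comp (ltT_trans q p) u v) (free_comp (ltT_trans q p) u' v').
Proof.
move=> uu vv uv uv'.
have E (G : infgpd) (f : gmap X G) := composable_exchange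
  (gpdmap_composable (free_ev f) uu) (gpdmap_composable (free_ev f) vv)
  (gpdmap_composable (free_ev f) uv) (gpdmap_composable (free_ev f) uv').
have E1 : composable (ltT_trans q p) (free_comp p u u') (free_comp p v v').
  by apply/free_composable => G f; rewrite !free_ev_comp //; have [] := E G f.
have E2 : composable p (free_comp (ltT_trans q p) u v) (free_comp (ltT_trans q p) u' v').
  by apply/free_composable => G f; rewrite !free_ev_comp //; have [] := E G f.
apply: free_ext => G f; rewrite !free_ev_comp //.
by apply: exchange; exact: gpdmap_composable.
Qed.

Lemma free_comp_identl j i (p : ltT j i) (u : free_glob i) :
  free_comp p (iident free_ident p (itgt p u)) u = u.
Proof.
apply: free_ext => G f; rewrite free_ev_comp.
  by rewrite free_ev_iident gfun_itgt comp_identl.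
apply/free_composable => {}G {}f; rewrite /composable free_ev_iident gfun_itgt.
exact: isrc_iident.
Qed.

Lemma free_comp_identr j i (p : ltT j i) (u : free_glob i) :
  free_comp p u (iident free_ident p (isrc p u)) = u.
Proof.
apply: free_ext => G f; rewrite free_ev_comp.
  by rewrite free_ev_iident gfun_isrc comp_identr.
apply/free_composable => {}G {}f; rewrite /composable free_ev_iident gfun_isrc.
by rewrite itgt_iident.
Qed.

Lemma free_ident_comp j i (p : ltT j i) (u v : free_glob i) :
  composable p u v ->
  free_ident (free_comp p u v) = free_comp (ltT_S p) (free_ident u) (free_ident v).
Proof.
move=> uv; apply: free_ext => G f; rewrite free_ev_ident !free_ev_comp //.
  by rewrite !free_ev_ident ident_comp //; exact: gpdmap_composable.
apply: etrans (congr1 (isrc p) (free_src_ident u)) _.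
exact: etrans uv (esym (congr1 (itgt p) (free_tgt_ident v))).
Qed.

Definition free_cat : infcat :=
  Infcat free_src_comp_base free_tgt_comp_base free_src_comp_S free_tgt_comp_S
    free_src_ident free_tgt_ident free_compA free_exchange free_comp_identl
    free_comp_identr free_ident_comp.

Lemma free_ev_inverse i (a b : free_cat i.+1) :
  (forall (G : infgpd) (f : gmap X G),
    is_inverse (free_ev f i.+1 a) (free_ev f i.+1 b)) -> is_inverse a b.
Proof.
move=> h.
have sb : src b = tgt a.
  by apply: free_ext => G f; have [hs _ _ _] := h G f; rewrite gfun_src hs gfun_tgt.
have tb : tgt b = src a.
  by apply: free_ext => G f; have [_ ht _ _] := h G f; rewrite gfun_tgt ht gfun_src.
split=> //; apply: free_ext => G f; have [_ _ e1 e2] := h G f.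
- by rewrite free_ev_comp // free_ev_ident gfun_tgt.
- by rewrite free_ev_comp // free_ev_ident gfun_src.
Qed.

Lemma free_inv i (a : free_cat i.+1) : exists b, is_inverse a b.
Proof. by have [b h] := free_inv_ex a; exists b; exact: free_ev_inverse. Qed.

Definition free_gpd : infgpd := Infgpd free_inv.

Definition free_evm (G : infgpd) (f : gmap X G) : gpdmap free_gpd G :=
  @Gpdmap free_gpd G (free_ev f) (fun j i p u v h => free_ev_comp f h)
    (fun i u => free_ev_ident u f).

Let unit_ex i (x : X i) : exists a : free_gpd i,
  forall (G : infgpd) (f : gmap X G), free_ev f i a = f i x.
Proof. exact: (free_term (valid_gen x)). Qed.

Let unit_fun i (x : X i) : free_gpd i := sval (cid (unit_ex x)).

Let unit_funE (G : infgpd) (f : gmap X G) i (x : X i) :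
  free_ev f i (unit_fun x) = f i x.
Proof. by rewrite /unit_fun; case: cid. Qed.

Let unit_src i (x : X i.+1) : unit_fun (src x) = src (unit_fun x).
Proof. by apply: free_ext => G f; rewrite gfun_src !unit_funE gfun_src. Qed.

Let unit_tgt i (x : X i.+1) : unit_fun (tgt x) = tgt (unit_fun x).
Proof. by apply: free_ext => G f; rewrite gfun_tgt !unit_funE gfun_tgt. Qed.

Definition free_unit : gmap X free_gpd := Gmap unit_src unit_tgt.

Lemma free_evm_unit (G : infgpd) (f : gmap X G) :
  gmap_comp (free_evm f) free_unit = f.
Proof. by apply: gmap_ext => i x; exact: unit_funE. Qed.

Lemma free_evm_uniq (G : infgpd) (g : gpdmap free_gpd G) :
  free_evm (gmap_comp g free_unit) = g.
Proof.
apply: gpdmap_ext => i a; have [t vt] := free_valid a.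
move=> /[dup] Ea /(_ G (gmap_comp g free_unit)) /= -> .
elim: vt a Ea => {i t} [i x|j i p t1 t2 v1 IH1 v2 IH2 c|i t vt IH|i t vt IH] a Ea /=.
- by congr (g i _); apply: free_ext => H f; rewrite Ea; exact: unit_funE.
- have [a1 E1] := free_term v1; have [a2 E2] := free_term v2.
  have h : composable p a1 a2.
    by apply/free_composable => H f; rewrite E1 E2; exact: c.
  have -> : a = comp (p : ltT j i) (a1 : free_gpd i) a2.
    by apply: free_ext => H f; rewrite Ea free_ev_comp // E1 E2.
  by rewrite gpdmap_comp // (IH1 a1) // (IH2 a2).
- have [b Eb] := free_term vt.
  have -> : a = ident (b : free_gpd i).
    by apply: free_ext => H f; rewrite Ea free_ev_ident Eb.
  by rewrite gpdmap_ident (IH b).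
- have [b Eb] := free_term vt; rewrite (IH b) //; apply/esym/inv_uniq.
  apply: gpdmap_inverse; apply: free_ev_inverse => H f.
  by rewrite Ea Eb; exact: invP.
Qed.

End FreeExistence.

Theorem left_adjoint_exists : inhabited left_adjoint.
Proof.
pose fm X Y (f : gmap X Y) : gpdmap (free_gpd X) (free_gpd Y) :=
  free_evm (gmap_comp (free_unit Y) f).
pose tr X (G : infgpd) (g : gpdmap (free_gpd X) G) : gmap X G :=
  gmap_comp g (free_unit X).
have trK X G : cancel (@tr X G) (@free_evm X G) by move=> g; exact: free_evm_uniq.
have evK X G : cancel (@free_evm X G) (@tr X G) by move=> f; exact: free_evm_unit.
have fmE X Y (f : gmap X Y) : tr _ _ (fm _ _ f) = gmap_comp (free_unit Y) f.
  exact: evK.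
have trr X G H (h : gpdmap G H) (g : gpdmap (free_gpd X) G) :
  tr _ _ (gpdmap_o h g) = gmap_comp h (tr _ _ g) by exact: gmap_ext.
have trl X Y G (f : gmap X Y) (g : gpdmap (free_gpd Y) G) :
    tr _ _ (gpdmap_o g (fm _ _ f)) = gmap_comp (tr _ _ g) f.
  by rewrite trr fmE; exact: gmap_ext.
split; apply: (@LeftAdjoint free_gpd fm _ _ tr) => // [X|X Y Z g f|X G].
- by apply: (can_inj (trK _ _)); rewrite fmE; exact: gmap_ext.
- apply: (can_inj (trK _ _)); rewrite fmE trl fmE; exact: gmap_ext.
- by exists (@free_evm X G).
Qed.

(* Main.v *)
From mathcomp Require Import all_boot.
From mathcomp Require Import boolp.
Require Import Defs.

Set Implicit Arguments.
Unset Strict Implicit.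
Unset Printing Implicit Defensive.

(** The free groupoid on a globular sum is deformed to a point by collapsing one
    dimension of one globe at a time, the last globe first.

    By Yoneda and the two universal properties, G = L(G_T) carries cells
    C_0, ..., C_w, one for each globe, glued along the cuts, and a morphism out
    of G is the same thing as a family of glued cells in its codomain
    ([free_on], [free_on_sum]).  Consider endomorphisms of G that fix
    C_0, ..., C_(l-1), send C_l to the iterated identity on its j-target, and
    send every later globe to the iterated identity on its gluing face.  For
    l = w and j = dim C_w this is the identity of G.  For l = 0 and j = 0 it is
    constant at the 0-target of C_0.  When j reaches the dimension of the cut
    between the globes l-1 and l, collapsing C_l further would break its gluing to
    C_(l-1); but at that point C_l has become an identity on the cut, and the
    endomorphism is already the one where the collapse of C_(l-1) begins
    ([stage_glue]).

    Two successive stages j+1 and j agree on cells of dimension < j and differ by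
    a homotopy concentrated in level j: a functorial choice of (j+1)-arrows
    h_u : f u -> g u for the j-cells u, strictly natural with respect to cells of
    dimension > j.  Such homotopies between morphisms G -> H are morphisms from
    G to a strict groupoid, the path object [pgpd H j], whose cells of dimension
    > j are commutative squares for o_j.  By freeness of G the homotopy is
    produced by giving its values on the C_l only: trivial cells for the globes
    before l, and for C_l the square [square y], which contracts a (j+1)-cell y
    to its target, degenerated to the dimension of C_l ([stage_collapse]).

    The two endpoints of a path-object loop are conjugate, so that a morphism
    homotopic to one with trivial image on pi_0 and on all pi_n also has trivial
    image ([pi_trivial_transfer]).  Starting from the constant endomorphism, this
    property propagates back to the identity of G. *)

(** * Comparing dimensions *)

Lemma ltT_asym j i : ltT j i -> ltT i j -> False.
Proof. by move=> /ltT_lt ji /ltT_lt; rewrite ltnNge ltnW. Qed.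

Lemma ltT_self i : ltT i i -> False.
Proof. by move=> p; exact: (ltT_asym p p). Qed.

Lemma ltT_asymS j i : ltT j i -> ltT i j.+1 -> False.
Proof. by move=> /ltT_lt ji /ltT_lt; rewrite ltnS leqNgt ji. Qed.

(** The path object treats the dimensions below, at and above its level
    differently.  The comparison is informative because iterated faces and
    identities are indexed by elements of [ltT]; the lemmas [dimP_lt], [dimP_eq]
    and [dimP_gt] determine the opaque [dimP]. *)
Inductive dim_cmp k m : Type := DimLt of ltT m k | DimEq of m = k | DimGt of ltT k m.

Lemma dimP k m : dim_cmp k m.
Proof.
case: (ltngtP m k) => h; [apply: DimLt|apply: DimGt|exact: DimEq]; exact: ltT_of.
Qed.

Lemma dimP_lt k m (q : ltT m k) : dimP k m = DimLt q.
Proof.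
case: dimP => [p|e|p]; first by rewrite (ltT_irr p q).
- by exfalso; subst m; exact: ltT_self q.
- by exfalso; exact: ltT_asym p q.
Qed.

Lemma dimP_eq k : dimP k k = DimEq erefl.
Proof.
case: dimP => [p|e|p]; try by exfalso; exact: ltT_self p.
by rewrite (eq_irrelevance e erefl).
Qed.

Lemma dimP_gt k m (q : ltT k m) : dimP k m = DimGt q.
Proof.
case: dimP => [p|e|p]; last by rewrite (ltT_irr p q).
- by exfalso; exact: ltT_asym p q.
- by exfalso; subst m; exact: ltT_self q.
Qed.

(** * Iterated identities *)

Local Notation iid := (iident (@ident _)).

Section Identities.
Variable G : infcat.

(** The iterated identity on a cell of dimension [j.+1].  Indexing by [ltT j i]
    rather than by [ltT j.+1 i] includes the case of no identity at all, and
    gives [degen q x] the faces of [x] along [q]. *)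
Fixpoint degen j i (q : ltT j i) : G j.+1 -> G i :=
  match q in ltT _ i return G j.+1 -> G i with
  | ltT_base => fun x => x
  | ltT_S _ q' => fun x => ident (degen q' x)
  end.

Lemma iid_trans l j i (q : ltT l j) (p : ltT j i) (x : G l) :
  iid (ltT_trans q p) x = iid p (iid q x).
Proof. by elim: p => [|{}i p IH] //=; congr ident. Qed.

Lemma iid_comp l j i (q : ltT l j) (p : ltT j i) (u v : G j) : composable q u v ->
  iid p (comp q u v) = comp (ltT_trans q p) (iid p u) (iid p v).
Proof.
move=> uv; elim: p => [|{}i p IH] /=; first exact: ident_comp.
rewrite [LHS](congr1 ident IH) ident_comp // /composable.
by rewrite isrc_trans itgt_trans isrc_iident itgt_iident.
Qed.

Lemma isrc_degen j i (q : ltT j i) (x : G j.+1) : isrc q (degen q x) = src x.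
Proof. by elim: q => [|{}i q IH] //=; rewrite src_ident. Qed.

Lemma itgt_degen j i (q : ltT j i) (x : G j.+1) : itgt q (degen q x) = tgt x.
Proof. by elim: q => [|{}i q IH] //=; rewrite tgt_ident. Qed.

Lemma degen_ident j i (q : ltT j i) (x : G j) : degen q (ident x) = iid q x.
Proof. by elim: q => [|{}i q IH] //=; congr ident. Qed.

Lemma degen_iid j i (q : ltT j i) (r : ltT j.+1 i) (x : G j.+1) : degen q x = iid r x.
Proof.
rewrite -(ltT_irr (ltT_trans ltT_base r) q).
by elim: r {q} => [|{}i r IH] //=; congr ident.
Qed.

Lemma degen_trans k j i (q : ltT k j) (p : ltT j i) (x : G k.+1) :
  degen (ltT_trans q p) x = iid p (degen q x).
Proof. by elim: p => [|{}i p IH] //=; congr ident. Qed.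

Lemma degen_comp l k i (r : ltT l k) (q : ltT k i) (a b : G k.+1) :
  composable (ltT_S r) a b ->
  degen q (comp (ltT_S r) a b) = comp (ltT_trans r q) (degen q a) (degen q b).
Proof.
move=> ab; elim: q => [|{}i q IH] //=; rewrite IH ident_comp // /composable.
by rewrite isrc_trans itgt_trans isrc_degen itgt_degen.
Qed.

Lemma degen_comp_base k i (q : ltT k i) (a b : G k.+1) :
  composable ltT_base a b -> degen q (comp ltT_base a b) = comp q (degen q a) (degen q b).
Proof.
move=> ab; elim: q => [|{}i q IH] //=; rewrite IH ident_comp // /composable.
by rewrite isrc_degen itgt_degen.
Qed.

Lemma comp_iid j i (p : ltT j i) (x : G j) : comp p (iid p x) (iid p x) = iid p x.
Proof. by have := comp_identl p (iid p x); rewrite itgt_iident. Qed.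

Lemma comp_degen k j i (q : ltT k j) (p : ltT j i) (x : G k.+1) :
  comp p (degen (ltT_trans q p) x) (degen (ltT_trans q p) x) = degen (ltT_trans q p) x.
Proof. by rewrite degen_trans comp_iid. Qed.

End Identities.
Arguments degen {G j i} q x.

(** * Cells of the path object *)

Section Cells.
Variables (H : infcat) (k : nat).

(** The square, commutative for the composition of level [k], with sides the
    m-cells [end0], [end1] and the (k+1)-cells [a] (between the k-sources) and
    [b] (between the k-targets). *)
Definition above m (q : ltT k m) (end0 end1 : H m) (a b : H k.+1) :=
  [/\ isrc q end0 = src a, itgt q end0 = src b, isrc q end1 = tgt a, itgt q end1 = tgt b
    & comp q end1 (degen q a) = comp q (degen q b) end0].

(** A cell of the path object of level [k] is an arrow from [end0] to [end1].
    Above level [k] it is a square.  At level [k] it is a (k+1)-cell, recorded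
    twice.  Below level [k] it is a plain cell, and its links are forced to be
    identities.  Quantifying each case over the comparison proofs keeps the four
    components in fixed types, so that no transport along m = k is needed. *)
Record pvalid m (end0 end1 : H m) (a b : H k.+1) : Prop := PValid {
  pv_gt : forall q : ltT k m, above q end0 end1 a b;
  pv_le : forall p : ltT m k.+1, [/\ b = a, isrc p a = end0 & itgt p a = end1];
  pv_lt : forall q : ltT m k, a = iid (ltT_S q) end0 }.

Lemma pvalid_gt m (q : ltT k m) end0 end1 a b : above q end0 end1 a b -> pvalid end0 end1 a b.
Proof.
move=> h; split=> [q'|p|p]; first by rewrite (ltT_irr q' q).
- by case: (ltT_asymS q p).
- by case: (ltT_asym q p).
Qed.

Lemma pvalid_eq (h : H k.+1) : pvalid (src h) (tgt h) h h.
Proof.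
split=> [q|p|q]; try by case: (ltT_self q).
by rewrite (ltT_irr p ltT_base).
Qed.

Lemma pvalid_lt m (q : ltT m k) (w : H m) :
  pvalid w w (iid (ltT_S q) w) (iid (ltT_S q) w).
Proof.
split=> [q'|p|q']; first by case: (ltT_asym q q').
- by rewrite (ltT_irr p (ltT_S q)) isrc_iident itgt_iident.
- by rewrite (ltT_irr q' q).
Qed.

Record pcell m := PCell { end0 : H m; end1 : H m; link_s : H k.+1; link_t : H k.+1;
  pcellP : pvalid end0 end1 link_s link_t }.

(** Below level [k] the links are determined by [end0], so that every later
    equality of cells has to be checked on links only in dimensions >= k. *)
Lemma pcell_ext m (u v : pcell m) : end0 u = end0 v -> end1 u = end1 v ->
  ((ltT m k -> False) -> link_s u = link_s v /\ link_t u = link_t v) -> u = v.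
Proof.
case: u v => [u0 u1 a b P] [v0 v1 a' b' P'] /= e0 e1 e.
subst v0 v1.
have [ea eb] : a = a' /\ b = b'.
  case: (dimP k m) => [q|q|q].
  - have [eb _ _] := pv_le P (ltT_S q); have [eb' _ _] := pv_le P' (ltT_S q).
    by have ea := pv_lt P q; have ea' := pv_lt P' q; rewrite eb eb' ea ea'.
  - by apply: e; subst m; exact: ltT_self.
  - by apply: e; exact: ltT_asym.
by subst a' b'; congr PCell; exact: Prop_irrelevance.
Qed.

(** Below level [k] the two ends and the two links have the same faces; this is
    what makes links composable as soon as the ends are. *)
Lemma pcell_faces m (u : pcell m) j (p : ltT j m) (r : ltT j k) :
  [/\ isrc p (end1 u) = isrc p (end0 u), isrc (ltT_S r) (link_s u) = isrc p (end0 u)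
    & isrc (ltT_S r) (link_t u) = isrc p (end0 u)] /\
  [/\ itgt p (end1 u) = itgt p (end0 u), itgt (ltT_S r) (link_s u) = itgt p (end0 u)
    & itgt (ltT_S r) (link_t u) = itgt p (end0 u)].
Proof.
have P := pcellP u.
have lo (p' : ltT m k.+1) : ltT_S r = ltT_trans p p' by exact: ltT_irr.
case: (dimP k m) => [q|e|q].
- have [-> <- <-] := pv_le P (ltT_S q); rewrite (lo (ltT_S q)) !isrc_trans !itgt_trans.
  by rewrite isrc_iglob itgt_iglob.
- subst m; have [-> <- <-] := pv_le P ltT_base; rewrite (lo ltT_base) !isrc_trans !itgt_trans.
  by rewrite isrc_iglob itgt_iglob.
- have [e1 e2 e3 e4 _] := pv_gt P q; rewrite (ltT_irr p (ltT_trans r q)).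
  have e5 : isrc r (src (link_t u)) = isrc r (src (link_s u)) by rewrite -e2 -isrc_iglob e1.
  have e6 : itgt r (tgt (link_s u)) = itgt r (src (link_t u)).
    by rewrite -itgt_globS -e1 itgt_iglob e2.
  by rewrite !isrc_trans !itgt_trans /= e1 e2 e3 e4 e5 e6 -isrc_globS -itgt_globS.
Qed.

End Cells.

(** * The strict category structure of the path object *)

Section Globular.
Variables (H : infcat) (k : nat).
Local Notation pcell := (pcell H k).

Definition face b m (x : H m.+1) : H m := if b then src x else tgt x.

(** Passing from dimension k+1 to dimension k turns a side of the square into a
    cell in its own right, namely the side over the chosen face. *)
Definition link_s_face b m (u : pcell m.+1) : H k.+1 :=
  match dimP k m with
  | DimLt q => iid (ltT_S q) (face b (end0 u))
  | DimEq _ => if b then link_s u else link_t u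
  | DimGt _ => link_s u
  end.

Definition link_t_face b m (u : pcell m.+1) : H k.+1 :=
  match dimP k m with
  | DimLt q => iid (ltT_S q) (face b (end0 u))
  | DimEq _ => if b then link_s u else link_t u
  | DimGt _ => link_t u
  end.

Lemma pface_valid b m (u : pcell m.+1) :
  pvalid (face b (end0 u)) (face b (end1 u)) (link_s_face b u) (link_t_face b u).
Proof.
have P := pcellP u; rewrite /link_s_face /link_t_face.
case: (dimP k m) => [q|e|q].
- have -> : face b (end1 u) = face b (end0 u); last exact: pvalid_lt.
  by have [[s _ _] [t _ _]] := pcell_faces u ltT_base q; case: b.
- subst m; have [e1 e2 e3 e4 _] := pv_gt P ltT_base; move: e1 e2 e3 e4 => /= e1 e2 e3 e4.
  by case: b; rewrite /= ?e1 ?e2 ?e3 ?e4; exact: pvalid_eq.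
- have [/= e1 e2 e3 e4 e5] := pv_gt P (ltT_S q); apply: (pvalid_gt (q := q)).
  have c1 : composable (ltT_S q) (end1 u) (ident (degen q (link_s u))).
    by rewrite /composable /= tgt_ident itgt_degen.
  have c2 : composable (ltT_S q) (ident (degen q (link_t u))) (end0 u).
    by rewrite /composable /= src_ident isrc_degen.
  case: b => /=; split.
  + by [].
  + by rewrite itgt_globS.
  + by [].
  + by rewrite itgt_globS.
  + by move/(congr1 src): e5; rewrite !src_comp_S // !src_ident.
  + by rewrite -isrc_globS.
  + by [].
  + by rewrite -isrc_globS.
  + by [].
  + by move/(congr1 tgt): e5; rewrite !tgt_comp_S // !tgt_ident.
Qed.

Definition pface b m (u : pcell m.+1) : pcell m := PCell (pface_valid b u).

Lemma pface_glob b m (u : pcell m.+2) :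
  pface b (pface true u) = pface b (pface false u).
Proof.
apply: pcell_ext => [||nk] /=; try by case: b; rewrite /= (src_glob, tgt_glob).
rewrite /link_s_face /link_t_face /= /link_s_face /link_t_face; case: (dimP k m) => [q|e|q].
- by case: nk.
- by subst m; rewrite (dimP_gt ltT_base).
- by rewrite (dimP_gt (ltT_S q)).
Qed.

Definition pglob : globset :=
  @Globset pcell (pface true) (pface false) (pface_glob true) (pface_glob false).

Lemma end0_isrc j m (p : ltT j m) (u : pglob m) : end0 (isrc p u) = isrc p (end0 u).
Proof. by elim: p u => [|{}m p IH] u //=; rewrite IH. Qed.

Lemma end1_isrc j m (p : ltT j m) (u : pglob m) : end1 (isrc p u) = isrc p (end1 u).
Proof. by elim: p u => [|{}m p IH] u //=; rewrite IH. Qed.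

Lemma end0_itgt j m (p : ltT j m) (u : pglob m) : end0 (itgt p u) = itgt p (end0 u).
Proof. by elim: p u => [|{}m p IH] u //=; rewrite IH. Qed.

Lemma end1_itgt j m (p : ltT j m) (u : pglob m) : end1 (itgt p u) = itgt p (end1 u).
Proof. by elim: p u => [|{}m p IH] u //=; rewrite IH. Qed.

Lemma link_s_faceE b m (q : ltT k m) (u : pglob m.+1) : link_s_face b u = link_s u.
Proof. by rewrite /link_s_face (dimP_gt q). Qed.

Lemma link_t_faceE b m (q : ltT k m) (u : pglob m.+1) : link_t_face b u = link_t u.
Proof. by rewrite /link_t_face (dimP_gt q). Qed.

Lemma link_face_gt j m (p : ltT j m) (u : pglob m) : ltT k j ->
  [/\ link_s (isrc p u) = link_s u, link_t (isrc p u) = link_t u,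
      link_s (itgt p u) = link_s u & link_t (itgt p u) = link_t u].
Proof.
move=> q; elim: p u => [|{}m p IH] u /=; first by rewrite !link_s_faceE ?link_t_faceE.
have [-> -> _ _] := IH (pface true u); have [_ _ -> ->] := IH (pface false u).
by rewrite /= !(link_s_faceE _ (ltT_trans q p)) !(link_t_faceE _ (ltT_trans q p)).
Qed.

Lemma link_face_eq m (p : ltT k m) (u : pglob m) :
  [/\ link_s (isrc p u) = link_s u, link_t (isrc p u) = link_s u,
      link_s (itgt p u) = link_t u & link_t (itgt p u) = link_t u].
Proof.
elim: p u => [|{}m p IH] u /=; first by rewrite /link_s_face /link_t_face dimP_eq.
have [-> -> _ _] := IH (pface true u); have [_ _ -> ->] := IH (pface false u).
by rewrite /= (link_s_faceE _ p) (link_t_faceE _ p).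
Qed.

(** Composability along a face of level [k] or more also involves the links;
    below level [k] it is visible on the ends. *)
Lemma pcomposableP j m (p : ltT j m) (u v : pglob m) :
  composable p u v <->
  [/\ composable p (end0 u) (end0 v), composable p (end1 u) (end1 v),
      j = k -> link_s u = link_t v & ltT k j -> link_s u = link_s v /\ link_t u = link_t v].
Proof.
split=> [c|[c0 c1 ceq cgt]].
  split; rewrite /composable.
  - by rewrite -end0_isrc c end0_itgt.
  - by rewrite -end1_isrc c end1_itgt.
  - move=> e; subst j; have [<- _ _ _] := link_face_eq p u.
    by have [_ _ <- _] := link_face_eq p v; rewrite c.
  - move=> q; have [<- <- _ _] := link_face_gt p u q.
    by have [_ _ <- <-] := link_face_gt p v q; rewrite c.
apply: pcell_ext => [||nk]; rewrite ?end0_isrc ?end1_isrc ?end0_itgt ?end1_itgt //.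
case: (dimP k j) => [//|e|q].
- subst j; have [-> -> _ _] := link_face_eq p u.
  by have [_ _ -> ->] := link_face_eq p v; rewrite ceq.
- have [-> -> _ _] := link_face_gt p u q.
  by have [_ _ -> ->] := link_face_gt p v q; exact: cgt.
Qed.

Lemma link_composable j m (p : ltT j m) (r : ltT j k) (u v : pglob m) :
  composable p (end0 u) (end0 v) ->
  composable (ltT_S r) (link_s u) (link_s v) /\ composable (ltT_S r) (link_t u) (link_t v).
Proof.
have [[_ e1 e2] _] := pcell_faces u p r; have [_ [_ e3 e4]] := pcell_faces v p r.
by rewrite /composable e1 e2 e3 e4.
Qed.

(** Links compose along levels below [k].  At level [k] squares are pasted side
    by side, and only the outer links remain.  Above level [k] the two squares
    share their links. *)
Definition link_s_comp j m (p : ltT j m) (u v : pglob m) : H k.+1 :=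
  match dimP k j with
  | DimLt r => comp (ltT_S r) (link_s u) (link_s v)
  | DimEq _ => link_s v
  | DimGt _ => link_s u
  end.

Definition link_t_comp j m (p : ltT j m) (u v : pglob m) : H k.+1 :=
  match dimP k j with
  | DimLt r => comp (ltT_S r) (link_t u) (link_t v)
  | DimEq _ => link_t u
  | DimGt _ => link_t u
  end.

(** Commutativity of a composite square: by exchange for two levels j < k, by
    pasting for j = k; for j > k the sides are identities for the composition of
    level [j], so that exchange applies after writing each as its own square. *)
Lemma pcomp_valid j m (p : ltT j m) (u v : pglob m) : composable p u v ->
  pvalid (comp p (end0 u) (end0 v)) (comp p (end1 u) (end1 v))
    (link_s_comp p u v) (link_t_comp p u v).
Proof.
move=> /[dup] c /pcomposableP[c0 c1 ceq cgt].
have P := pcellP u; have Q := pcellP v; split=> [q|p'|q].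
- have [a1 a2 a3 a4 a5] := pv_gt P q; have [b1 b2 b3 b4 b5] := pv_gt Q q.
  have d1 : composable q (end1 u) (degen q (link_s u)) by rewrite /composable itgt_degen.
  have d2 : composable q (end1 v) (degen q (link_s v)) by rewrite /composable itgt_degen.
  have d3 : composable q (degen q (link_t u)) (end0 u) by rewrite /composable isrc_degen.
  have d4 : composable q (degen q (link_t v)) (end0 v) by rewrite /composable isrc_degen.
  rewrite /link_s_comp /link_t_comp; case: (dimP k j) => [r|e|r].
  + have [n1 n2] := link_composable r c0.
    have f1 : composable (ltT_trans r q) (degen q (link_s u)) (degen q (link_s v)).
      by rewrite /composable isrc_trans itgt_trans isrc_degen itgt_degen.
    have f2 : composable (ltT_trans r q) (degen q (link_t u)) (degen q (link_t v)).
      by rewrite /composable isrc_trans itgt_trans isrc_degen itgt_degen.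
    rewrite (ltT_irr p (ltT_trans r q)) in c0 c1 *.
    split; rewrite ?isrc_comp_trans ?itgt_comp_trans ?src_comp_S ?tgt_comp_S //.
    * by rewrite a1 b1.
    * by rewrite a2 b2.
    * by rewrite a3 b3.
    * by rewrite a4 b4.
    * by rewrite !degen_comp // -!exchange // a5 b5.
  + subst j; rewrite (ltT_irr p q) in c0 c1 *.
    split; rewrite ?isrc_comp ?itgt_comp //.
    rewrite -(ceq erefl) in b5 d4.
    by rewrite (compA c1 d2) b5 -(compA d1 d4) a5 (compA d3 c0).
  + have [ea eb] := cgt r.
    rewrite -{}ea in b1 b3 b5 d2; rewrite -{}eb in b2 b4 b5 d4.
    have eq := ltT_irr q (ltT_trans r p); subst q.
    split; rewrite ?isrc_trans ?itgt_trans ?isrc_comp ?itgt_comp //.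
    * by rewrite -isrc_trans.
    * by rewrite -itgt_trans.
    * by rewrite -isrc_trans.
    * by rewrite -itgt_trans.
    * have f a : composable p (degen (ltT_trans r p) a : H m) (degen (ltT_trans r p) a).
        by rewrite /composable degen_trans isrc_iident itgt_iident.
      by rewrite -(comp_degen r p (link_s u)) -(comp_degen r p (link_t u)) !exchange // a5 b5.
- have [a1 a2 a3] := pv_le P p'; have [b1 b2 b3] := pv_le Q p'.
  rewrite /link_s_comp /link_t_comp; case: (dimP k j) => [r|e|r].
  + have [n1 n2] := link_composable r c0; rewrite a1 b1.
    rewrite (ltT_irr (ltT_S r) (ltT_trans p p')) in n1 n2 *.
    by rewrite isrc_comp_trans // itgt_comp_trans // a2 a3 b2 b3.
  + by subst j; case: (ltT_asymS p p').
  + by case: (ltT_asymS (ltT_trans r p) p').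
- rewrite /link_s_comp; case: (dimP k j) => [r|e|r].
  + rewrite (pv_lt P q) (pv_lt Q q) iid_comp //.
    by congr comp; exact: ltT_irr.
  + by subst j; case: (ltT_asym p q).
  + by case: (ltT_asym (ltT_trans r p) q).
Qed.

(** Composition has to be total; the value on a non-composable pair is
    arbitrary. *)
Definition pcomp j m (p : ltT j m) (u v : pglob m) : pglob m :=
  match pselect (composable p u v) with
  | left c => PCell (pcomp_valid c)
  | right _ => u
  end.

Lemma pcompE j m (p : ltT j m) (u v : pglob m) (c : composable p u v) :
  pcomp p u v = PCell (pcomp_valid c).
Proof.
by rewrite /pcomp; case: pselect => [c'|//]; congr PCell; exact: Prop_irrelevance.
Qed.

(** The links of an identity are those of the cell itself, in every dimension:
    from dimension k-1 to k an identity link becomes the (k+1)-cell, and from k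
    to k+1 the (k+1)-cell becomes both sides of a degenerate square. *)
Lemma pident_valid m (u : pglob m) :
  pvalid (ident (end0 u)) (ident (end1 u)) (link_s u) (link_t u).
Proof.
have P := pcellP u; split=> [q|p|q].
- case: (dimP k m) => [r|e|r]; first by case: (ltT_asymS r q).
  + subst m; have [a1 a2 a3] := pv_le P ltT_base.
    rewrite (ltT_irr q ltT_base) a1 -a2 -a3 /=; split=> /=; rewrite ?src_ident ?tgt_ident //=.
    by have := comp_identl ltT_base (link_s u); have /= -> := comp_identr ltT_base (link_s u).
  + have [a1 a2 a3 a4 a5] := pv_gt P r; rewrite (ltT_irr q (ltT_S r)).
    have d1 : composable r (end1 u) (degen r (link_s u)) by rewrite /composable itgt_degen.
    have d2 : composable r (degen r (link_t u)) (end0 u) by rewrite /composable isrc_degen.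
    by split; rewrite /= ?src_ident ?tgt_ident // -!ident_comp // a5.
- have q : ltT m k by apply: ltT_of; have := ltT_lt p.
  have [a1 a2 a3] := pv_le P (ltT_S q); split=> //.
    by rewrite (pv_lt P q) (ltT_irr (ltT_S q) (ltT_trans ltT_base p)) iid_trans isrc_iident.
  rewrite -a3 (pv_lt P q) itgt_iident.
  by rewrite (ltT_irr (ltT_S q) (ltT_trans ltT_base p)) iid_trans itgt_iident.
- rewrite (pv_lt P (ltT_pred q)).
  by rewrite (ltT_irr (ltT_S (ltT_pred q)) (ltT_trans ltT_base (ltT_S q))) iid_trans.
Qed.

Definition pident m (u : pglob m) : pglob m.+1 := PCell (pident_valid u).


Lemma psrc_comp_base i (u v : pglob i.+1) :
  composable ltT_base u v -> src (pcomp ltT_base u v) = src v.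
Proof.
move=> c; rewrite (pcompE c); have /pcomposableP[c0 c1 ceq cgt] := c.
apply: pcell_ext => [||nk] /=; rewrite ?src_comp_base //.
rewrite /link_s_face /link_t_face /= /link_s_comp /link_t_comp; case: (dimP k i) => [//|//|q].
exact: cgt.
Qed.

Lemma ptgt_comp_base i (u v : pglob i.+1) :
  composable ltT_base u v -> tgt (pcomp ltT_base u v) = tgt u.
Proof.
move=> c; rewrite (pcompE c); have /pcomposableP[c0 c1 ceq cgt] := c.
apply: pcell_ext => [||nk] /=; rewrite ?tgt_comp_base //.
by rewrite /link_s_face /link_t_face /= /link_s_comp /link_t_comp; case: (dimP k i).
Qed.

Lemma psrc_comp_S j i (p : ltT j i) (u v : pglob i.+1) :
  composable (ltT_S p) u v ->
  src (pcomp (ltT_S p) u v) = pcomp p (src u) (src v).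
Proof.
move=> c; have [c' _] := composable_faces c; rewrite (pcompE c) (pcompE c').
have /pcomposableP[c0 c1 _ _] := c.
apply: pcell_ext => [||nk] /=; rewrite ?src_comp_S //.
rewrite /link_s_face /link_t_face /= /link_s_comp /link_t_comp /= /link_s_face /link_t_face.
by case: (dimP k i) => [//|e|q]; first by subst i; rewrite (dimP_lt p).
Qed.

Lemma ptgt_comp_S j i (p : ltT j i) (u v : pglob i.+1) :
  composable (ltT_S p) u v ->
  tgt (pcomp (ltT_S p) u v) = pcomp p (tgt u) (tgt v).
Proof.
move=> c; have [_ c'] := composable_faces c; rewrite (pcompE c) (pcompE c').
have /pcomposableP[c0 c1 _ _] := c.
apply: pcell_ext => [||nk] /=; rewrite ?tgt_comp_S //.
rewrite /link_s_face /link_t_face /= /link_s_comp /link_t_comp /= /link_s_face /link_t_face.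
by case: (dimP k i) => [//|e|q]; first by subst i; rewrite (dimP_lt p).
Qed.

Lemma pface_ident b i (u : pglob i) : pface b (pident u) = u.
Proof.
apply: pcell_ext => [||nk] /=; try by case: b; rewrite /= (src_ident, tgt_ident).
rewrite /link_s_face /link_t_face /=; case: (dimP k i) => [q|e|q] //.
by subst i; have [-> _ _] := pv_le (pcellP u) ltT_base; case: b.
Qed.

Lemma isrc_pcomp j i (p : ltT j i) (u v : pglob i) :
  composable p u v -> isrc p (pcomp p u v) = isrc p v.
Proof.
elim: p u v => [|{}i p IH] u v h; first exact: psrc_comp_base.
by rewrite [LHS](congr1 (isrc p) (psrc_comp_S h)) IH //; have [] := composable_faces h.
Qed.

Lemma itgt_pcomp j i (p : ltT j i) (u v : pglob i) :
  composable p u v -> itgt p (pcomp p u v) = itgt p u.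
Proof.
elim: p u v => [|{}i p IH] u v h; first exact: ptgt_comp_base.
by rewrite [LHS](congr1 (itgt p) (ptgt_comp_S h)) IH //; have [] := composable_faces h.
Qed.

Lemma isrc_pcomp_trans l j i (q : ltT l j) (p : ltT j i) (u v : pglob i) :
  composable (ltT_trans q p) u v ->
  isrc p (pcomp (ltT_trans q p) u v) = pcomp q (isrc p u) (isrc p v).
Proof.
elim: p u v => [|{}i p IH] u v h; first exact: psrc_comp_S.
by rewrite [LHS](congr1 (isrc p) (psrc_comp_S h)) IH //; have [] := composable_faces h.
Qed.

Lemma itgt_pcomp_trans l j i (q : ltT l j) (p : ltT j i) (u v : pglob i) :
  composable (ltT_trans q p) u v ->
  itgt p (pcomp (ltT_trans q p) u v) = pcomp q (itgt p u) (itgt p v).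
Proof.
elim: p u v => [|{}i p IH] u v h; first exact: ptgt_comp_S.
by rewrite [LHS](congr1 (itgt p) (ptgt_comp_S h)) IH //; have [] := composable_faces h.
Qed.

Lemma pcompA j i (p : ltT j i) (u v w : pglob i) :
  composable p u v -> composable p v w ->
  pcomp p (pcomp p u v) w = pcomp p u (pcomp p v w).
Proof.
move=> uv vw.
have c1 : composable p (pcomp p u v) w by rewrite /composable isrc_pcomp.
have c2 : composable p u (pcomp p v w) by rewrite /composable itgt_pcomp.
rewrite (pcompE c1) (pcompE c2).
have /pcomposableP[a0 a1 _ _] := uv; have /pcomposableP[b0 b1 _ _] := vw.
apply: pcell_ext => [||nk] /=;
  rewrite /link_s_comp /link_t_comp ?(pcompE uv) ?(pcompE vw) /= ?compA //.
rewrite /link_s_comp /link_t_comp; case: (dimP k j) => [r|//|//].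
have [n1 n2] := link_composable r a0; have [n3 n4] := link_composable r b0.
by rewrite !compA.
Qed.

Lemma pexchange l j i (q : ltT l j) (p : ltT j i) (u u' v v' : pglob i) :
  composable p u u' -> composable p v v' ->
  composable (ltT_trans q p) u v -> composable (ltT_trans q p) u' v' ->
  pcomp (ltT_trans q p) (pcomp p u u') (pcomp p v v') =
  pcomp p (pcomp (ltT_trans q p) u v) (pcomp (ltT_trans q p) u' v').
Proof.
move=> uu vv uv uv'.
have c1 : composable (ltT_trans q p) (pcomp p u u') (pcomp p v v').
  rewrite /composable isrc_trans itgt_trans isrc_pcomp // itgt_pcomp //.
  by rewrite -isrc_trans uv' itgt_trans -vv itgt_iglob.
have c2 : composable p (pcomp (ltT_trans q p) u v) (pcomp (ltT_trans q p) u' v').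
  by rewrite /composable isrc_pcomp_trans // itgt_pcomp_trans // uu vv.
rewrite (pcompE c1) (pcompE c2).
have /pcomposableP[a0 a1 _ _] := uu; have /pcomposableP[b0 b1 _ _] := vv.
have /pcomposableP[d0 d1 _ _] := uv; have /pcomposableP[e0 e1 _ _] := uv'.
apply: pcell_ext => [||nk] /=; rewrite /link_s_comp /link_t_comp ?(pcompE uu) ?(pcompE vv)
  ?(pcompE uv) ?(pcompE uv') /= ?exchange //.
rewrite /link_s_comp /link_t_comp; case: (dimP k j) => [r|e|r].
- have [n1 n2] := link_composable r a0; have [n3 n4] := link_composable r b0.
  rewrite (dimP_lt (ltT_trans q r)).
  have [n5 n6] := link_composable (ltT_trans q r) d0.
  have [n7 n8] := link_composable (ltT_trans q r) e0.
  by rewrite (ltT_irr (ltT_S (ltT_trans q r)) (ltT_trans q (ltT_S r))) in n5 n6 n7 n8 *;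
    rewrite !exchange.
- by subst j; rewrite (dimP_lt q).
- by case: (dimP k l).
Qed.

Lemma end0_piid j i (p : ltT j i) (u : pglob j) : end0 (iident pident p u) = iid p (end0 u).
Proof. by elim: p => [|{}i p IH] //=; rewrite IH. Qed.

Lemma end1_piid j i (p : ltT j i) (u : pglob j) : end1 (iident pident p u) = iid p (end1 u).
Proof. by elim: p => [|{}i p IH] //=; rewrite IH. Qed.

Lemma link_piid j i (p : ltT j i) (u : pglob j) :
  link_s (iident pident p u) = link_s u /\ link_t (iident pident p u) = link_t u.
Proof. by elim: p => [|{}i p IH]. Qed.

Lemma isrc_piid j i (p : ltT j i) (u : pglob j) : isrc p (iident pident p u) = u.
Proof.
elim: p => [|{}i p IH]; first exact: pface_ident.
by rewrite [LHS](congr1 (@isrc pglob j i p) (pface_ident true _)).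
Qed.

Lemma itgt_piid j i (p : ltT j i) (u : pglob j) : itgt p (iident pident p u) = u.
Proof.
elim: p => [|{}i p IH]; first exact: pface_ident.
by rewrite [LHS](congr1 (@itgt pglob j i p) (pface_ident false _)).
Qed.

Lemma link_low j (r : ltT j k) (u : pglob j) :
  link_s u = iid (ltT_S r) (end0 u) /\ link_t u = iid (ltT_S r) (end0 u).
Proof.
have P := pcellP u; have [-> _ _] := pv_le P (ltT_S r).
by rewrite -(pv_lt P r).
Qed.

Lemma pcomp_identl j i (p : ltT j i) (u : pglob i) :
  pcomp p (iident pident p (itgt p u)) u = u.
Proof.
have c : composable p (iident pident p (itgt p u)) u by rewrite /composable isrc_piid.
rewrite (pcompE c); apply: pcell_ext => [||nk] /=.
- by rewrite end0_piid end0_itgt comp_identl.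
- by rewrite end1_piid end1_itgt comp_identl.
rewrite /link_s_comp /link_t_comp; have [-> ->] := link_piid p (itgt p u).
case: (dimP k j) => [r|e|r].
- have [-> ->] := link_low r (itgt p u); rewrite end0_itgt.
  have [_ [_ e1 e2]] := pcell_faces u p r.
  by split; [rewrite -e1|rewrite -e2]; exact: comp_identl.
- by subst j; have [_ _ _ ->] := link_face_eq p u.
- by have [_ _ -> ->] := link_face_gt p u r.
Qed.

Lemma pcomp_identr j i (p : ltT j i) (u : pglob i) :
  pcomp p u (iident pident p (isrc p u)) = u.
Proof.
have c : composable p u (iident pident p (isrc p u)) by rewrite /composable itgt_piid.
rewrite (pcompE c); apply: pcell_ext => [||nk] /=.
- by rewrite end0_piid end0_isrc comp_identr.
- by rewrite end1_piid end1_isrc comp_identr.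
rewrite /link_s_comp /link_t_comp; have [-> ->] := link_piid p (isrc p u).
case: (dimP k j) => [r|e|r].
- have [-> ->] := link_low r (isrc p u); rewrite end0_isrc.
  have [[_ e1 e2] _] := pcell_faces u p r.
  by split; [rewrite -e1|rewrite -e2]; exact: comp_identr.
- by subst j; have [-> _ _ _] := link_face_eq p u.
- by [].
Qed.

Lemma pident_comp j i (p : ltT j i) (u v : pglob i) : composable p u v ->
  pident (pcomp p u v) = pcomp (ltT_S p) (pident u) (pident v).
Proof.
move=> c; have c' : composable (ltT_S p) (pident u) (pident v).
  by rewrite /composable /= !pface_ident.
rewrite (pcompE c) (pcompE c'); have /pcomposableP[c0 c1 _ _] := c.
by apply: pcell_ext => [||nk] /=; rewrite ?ident_comp.
Qed.

Definition pcat : infcat :=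
  @Infcat pglob pcomp pident psrc_comp_base ptgt_comp_base psrc_comp_S ptgt_comp_S
    (pface_ident true) (pface_ident false) pcompA pexchange pcomp_identl pcomp_identr
    pident_comp.

End Globular.

(** * Inverses in the path object *)

Section Inverses.
Variable H : infgpd.

Lemma is_inverse_uniq i (u v w : H i.+1) : is_inverse u v -> is_inverse u w -> v = w.
Proof.
case=> vs vt e1 e2 [ws wt e3 e4].
have <- := comp_identr ltT_base v; rewrite /= vs -e3 -compA //.
by rewrite e2 -wt; have /= -> := comp_identl ltT_base w.
Qed.

(** An arrow h : a -> b of dimension m+2 is also invertible for the composition
    of level [m]: whiskering the inverse of [h] by a' and b' gives an arrow from
    a' to b', and exchange reduces both composites to the invertibility of [h].
    In dimension k of the path object of level [k] the inverse along level k-1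
    is of this kind. *)
Lemma whisker_inverse m (h : H m.+2) (a' b' : H m.+1) :
  is_inverse (src h) a' -> is_inverse (tgt h) b' ->
  exists h', [/\ src h' = a', tgt h' = b',
    comp (ltT_S ltT_base) h h' = ident (ident (tgt (src h)))
    & comp (ltT_S ltT_base) h' h = ident (ident (src (src h)))].
Proof.
set a := src h; set b := tgt h; case=> a's a't aa' a'a [b's b't bb' b'b].
have sab : src b = src a by rewrite /a /b src_glob.
have tab : tgt b = tgt a by rewrite /a /b tgt_glob.
have [g [gs gt hg gh]] := gpd_inv h; rewrite -/a -/b in gs gt hg gh.
pose p : ltT m m.+2 := ltT_S ltT_base.
have ga' : composable p (ident a') g.
  by rewrite /composable /= src_ident -tgt_glob gs tab.
have gb' : composable p g (ident b').
  by rewrite /composable /= tgt_ident gs b't.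
have c1 : composable p (comp p (ident a') g) (ident b').
  by rewrite /composable isrc_comp.
have a'1 : comp ltT_base a' (comp ltT_base b b') = a'.
  by rewrite bb' tab -a's; exact: (comp_identr ltT_base a').
exists (comp p (comp p (ident a') g) (ident b')).
have ha' : composable p h (ident a') by rewrite /composable /= tgt_ident a't.
have b'h : composable p (ident b') h.
  by rewrite /composable /= src_ident -tgt_glob b's tab.
rewrite src_comp_S // tgt_comp_S // src_comp_S // tgt_comp_S // !src_ident !tgt_ident gs gt.
split.
- by rewrite compA ?a'1 // /composable /= ?a's ?b't ?tab.
- by rewrite a'a -sab -b't; exact: (comp_identl ltT_base b').
- have ha'g : composable p (comp p h (ident a')) g by rewrite /composable isrc_comp.
  rewrite -compA //; last by rewrite /composable itgt_comp.
  rewrite -[comp p h (comp p _ _)]compA //.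
  have -> : comp p (comp p h (ident a')) g = ident b.
    have d1 : comp (ltT_base : ltT m.+1 m.+2) (comp p h (ident a')) (ident (ident (tgt a)))
              = comp p h (ident a').
      have := comp_identr ltT_base (comp p h (ident a')).
      by rewrite /= src_comp_S // src_ident aa'.
    have d2 : comp (ltT_base : ltT m.+1 m.+2) (ident a) g = g.
      by have := comp_identl ltT_base g; rewrite /= gt.
    rewrite -{1}d1 -{1}d2 [p](_ : _ = ltT_trans ltT_base ltT_base) // exchange //=.
    + have -> : comp (ltT_S ltT_base) (comp (ltT_S ltT_base) h (ident a')) (ident a) = h.
        have a'ia : composable p (ident a') (ident a).
          by rewrite /composable /= src_ident tgt_ident a's.
        rewrite (compA ha' a'ia).
        rewrite -(ident_comp (a's : composable ltT_base a' a)) a'a.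
        exact: (comp_identr p h).
      have -> : comp (ltT_S ltT_base) (ident (ident (tgt a))) g = g.
        by have := comp_identl p g; rewrite /= -tgt_glob gs tab.
      by [].
    + by rewrite /composable /= tgt_ident src_comp_S // src_ident aa'.
    + by rewrite /composable /= src_ident gt.
    + by rewrite -/p /composable isrc_comp //= src_ident tgt_ident a's.
    + by rewrite /composable /= !src_ident -tgt_glob gs tab.
  by rewrite -ident_comp ?bb' ?tab // /composable /= b't.
- have gb'h : composable p g (comp p (ident b') h) by rewrite /composable itgt_comp.
  rewrite (compA c1 b'h) (compA ga' gb'h).
  have -> : comp p g (comp p (ident b') h) = ident a.
    have d1 : comp (ltT_base : ltT m.+1 m.+2) (ident (ident (src a))) (comp p (ident b') h)
              = comp p (ident b') h.
      have := comp_identl ltT_base (comp p (ident b') h).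
      by rewrite /= tgt_comp_S // tgt_ident b'b sab.
    have d2 : comp (ltT_base : ltT m.+1 m.+2) g (ident b) = g.
      by have := comp_identr ltT_base g; rewrite /= gs.
    rewrite -{1}d1 -{1}d2 [p](_ : _ = ltT_trans ltT_base ltT_base) // exchange //=.
    + have -> : comp (ltT_S ltT_base) (ident b) (comp (ltT_S ltT_base) (ident b') h) = h.
        have bb'c : composable p (ident b) (ident b').
          by rewrite /composable /= src_ident tgt_ident b't.
        rewrite -(compA bb'c b'h).
        rewrite -(ident_comp (esym b't : composable ltT_base b b')) bb'.
        exact: (comp_identl p h).
      have -> : comp (ltT_S ltT_base) g (ident (ident (src a))) = g.
        by have := comp_identr p g; rewrite /= gs sab.
      by [].
    + by rewrite /composable /= tgt_ident gs.
    + by rewrite /composable /= src_ident tgt_comp_S // tgt_ident b'b sab.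
    + by rewrite /composable /= gs !tgt_ident sab.
    + by rewrite -/p /composable itgt_comp //= src_ident tgt_ident b't.
  by rewrite -ident_comp ?a'a // /composable /= a's.
Qed.

End Inverses.

Section HomotopyGroupoid.
Variable H : infgpd.

(** Turning a square around exchanges its links in dimension k+1, where it is
    turned along level k, and keeps them in higher dimensions.  In dimension k
    the cell is its own link and must be inverted along level k-1. *)
Lemma pinverse_intro k m (u v : pcat H k m.+1) :
  is_inverse (end0 u) (end0 v) -> is_inverse (end1 u) (end1 v) ->
  (m = k -> link_s v = link_t u /\ link_t v = link_s u) ->
  (ltT k m -> link_s v = link_s u /\ link_t v = link_t u) ->
  (forall r : ltT m k, m.+1 = k ->
    comp (ltT_S r) (link_s u) (link_s v) = iid (ltT_S r) (tgt (end0 u)) /\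
    comp (ltT_S r) (link_s v) (link_s u) = iid (ltT_S r) (src (end0 u))) ->
  is_inverse u v.
Proof.
case=> s0 t0 e0 e0' [s1 t1 e1 e1'] neq ngt nlt.
have vs : src v = tgt u.
  apply: pcell_ext => [||nk] //=; rewrite /link_s_face /link_t_face.
  by case: (dimP k m) => [//|/neq[-> _]|/ngt[-> ->]].
have vt : tgt v = src u.
  apply: pcell_ext => [||nk] //=; rewrite /link_s_face /link_t_face.
  by case: (dimP k m) => [//|/neq[_ ->]|/ngt[-> ->]].
have c : composable ltT_base u v by [].
have c' : composable ltT_base v u by [].
split=> //; [rewrite [LHS](pcompE c)|rewrite [LHS](pcompE c')]; apply: pcell_ext => [||nk] //=.
- rewrite /link_s_comp /link_t_comp /link_s_face /link_t_face; case: (dimP k m) => [r|e|q] //.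
    have e : m.+1 = k by case: (dimP k m.+1) => [/nk|//|/(ltT_asymS r)].
    have [<- _] := nlt r e.
    have p : ltT m.+1 k.+1 by rewrite e; exact: ltT_base.
    by have [-> _ _] := pv_le (pcellP u) p; have [-> _ _] := pv_le (pcellP v) p.
  by have [-> _] := neq e.
- rewrite /link_s_comp /link_t_comp /link_s_face /link_t_face; case: (dimP k m) => [r|e|q] //.
    have e : m.+1 = k by case: (dimP k m.+1) => [/nk|//|/(ltT_asymS r)].
    have [_ <-] := nlt r e.
    have p : ltT m.+1 k.+1 by rewrite e; exact: ltT_base.
    by have [-> _ _] := pv_le (pcellP u) p; have [-> _ _] := pv_le (pcellP v) p.
  by have [_ ->] := neq e.
by have [-> ->] := ngt q.
Qed.

(** Composites along a lower level invert componentwise.  Applied to both sides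
    of the equation of a square, this shows that the inverse ends form a square
    with the same links. *)
Lemma is_inverse_comp k m (q : ltT k m) (u v a b : H m.+1) :
  is_inverse u a -> is_inverse v b -> composable (ltT_S q) u v ->
  is_inverse (comp (ltT_S q) u v) (comp (ltT_S q) a b).
Proof.
case=> sa ta ua au [sb tb vb bv] uv; have [uvs uvt] := composable_faces uv.
have ab : composable (ltT_S q) a b.
  by rewrite /composable /= sa tb -isrc_globS itgt_globS; exact: uv.
have cua : composable ltT_base u a by [].
have cau : composable ltT_base a u by [].
have cvb : composable ltT_base v b by [].
have cbv : composable ltT_base b v by [].
split.
- by rewrite src_comp_S // tgt_comp_S // sa sb.
- by rewrite src_comp_S // tgt_comp_S // ta tb.
- rewrite -(exchange (q := q) cua cvb uv ab) ua vb tgt_comp_S //.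
  by rewrite ident_comp.
- rewrite -(exchange (q := q) cau cbv ab uv) au bv src_comp_S //.
  by rewrite ident_comp.
Qed.

Lemma is_inverse_ident m (x : H m) : is_inverse (ident x) (ident x).
Proof.
by split; rewrite ?src_ident ?tgt_ident //; have := comp_identl ltT_base (ident x);
  rewrite /= tgt_ident.
Qed.

Lemma pinverse k m (u : pcat H k m.+1) : exists v : pcat H k m.+1, is_inverse u v.
Proof.
have U := pcellP u.
have [a ia] := gpd_inv (end0 u); have [b ib] := gpd_inv (end1 u).
have [sa ta ua au] := ia; have [sb tb ub bu] := ib.
case: (dimP k m) => [r|e|q].
- case: (dimP k m.+1) => [r'|e|q]; last by case: (ltT_asymS r q).
    have e : end1 u = end0 u.
      by have [_ <- <-] := pv_le U (ltT_S r'); rewrite (pv_lt U r') isrc_iident itgt_iident.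
    exists (PCell (pvalid_lt r' a)); apply: pinverse_intro => //=.
    + by rewrite e.
    + by move=> e'; subst m; case: (ltT_self r).
    + by move=> q; case: (ltT_asym r q).
    + by move=> r2 e'; subst k; case: (ltT_self r').
  subst k.
  have [e1 e2 e3] := pv_le U ltT_base.
  have ia' : is_inverse (src (link_s u)) a by rewrite [src _]e2.
  have ib' : is_inverse (tgt (link_s u)) b by rewrite [tgt _]e3.
  have [n [ns nt n1 n2]] := whisker_inverse ia' ib'.
  exists (PCell (pvalid_eq n)); apply: pinverse_intro; rewrite /= ?ns ?nt //.
  + by move=> e'; case: (ltT_self (eq_rect _ (ltT m) r _ (esym e'))).
  + by move=> q; case: (ltT_asym r q).
  + move=> r' _; rewrite (ltT_irr r' ltT_base) n1 n2 /= -e2; split=> //.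
- subst m; have [/= e1 e2 e3 e4 e5] := pv_gt U ltT_base.
  have V : pvalid a b (link_t u) (link_s u).
    apply: (pvalid_gt (q := ltT_base)); split; rewrite /= ?sa ?ta ?sb ?tb //.
    (* end1 link_s = link_t end0, multiplied by the inverses on both sides *)
    have c1 : composable ltT_base (link_t u) (end0 u) by [].
    have c2 : composable ltT_base (end1 u) (link_s u) by [].
    have c3 : composable ltT_base (end0 u) a by [].
    have c4 : composable ltT_base b (end1 u) by [].
    have c5 : composable ltT_base (link_s u) a by rewrite /composable /= -e1.
    have c6 : composable ltT_base b (comp ltT_base (link_t u) (end0 u)).
      by rewrite /composable /= tgt_comp_base // sb e4.
    have /= <- := comp_identr ltT_base (link_t u).
    rewrite -e2 -ua -(compA c1 c3) -(compA c6) -?e5; last by rewrite /composable isrc_comp.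
    by rewrite -(compA c4 c2) bu e3; have /= -> := comp_identl ltT_base (link_s u).
  exists (PCell V); apply: pinverse_intro => //=.
  + by move=> q; case: (ltT_self q).
  + by move=> q; case: (ltT_self q).
- have [e1 e2 e3 e4 e5] := pv_gt U (ltT_S q).
  have V : pvalid a b (link_s u) (link_t u).
    apply: (pvalid_gt (q := ltT_S q)); move: e1 e2 e3 e4 => /= e1 e2 e3 e4.
    split; rewrite /= ?sa ?ta ?sb ?tb -?isrc_globS -?itgt_globS ?isrc_globS ?itgt_globS //.
    + by rewrite -isrc_globS.
    + by rewrite -isrc_globS.
    (* both composites are the inverse of the diagonal of the square of u *)
    apply: is_inverse_uniq (is_inverse_comp ib (is_inverse_ident _) _) _.
      by rewrite /composable /= tgt_ident itgt_degen.
    rewrite [X in is_inverse X]e5.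
    apply: is_inverse_comp => //; first exact: is_inverse_ident.
    by rewrite /composable /= src_ident isrc_degen.
  exists (PCell V); apply: pinverse_intro => //=.
  + by move=> e; subst m; case: (ltT_self q).
  + by move=> r; case: (ltT_asym r q).
Qed.

Section Projections.
Variable k : nat.

Definition pgpd : infgpd := Infgpd (@pinverse k).

Definition p0 : gmap pgpd H :=
  @Gmap pgpd H (fun m u => end0 u) (fun _ _ => erefl) (fun _ _ => erefl).
Definition p1 : gmap pgpd H :=
  @Gmap pgpd H (fun m u => end1 u) (fun _ _ => erefl) (fun _ _ => erefl).

Lemma p0_comp j i (p : ltT j i) (u v : pgpd i) : composable p u v ->
  p0 i (comp p u v) = comp p (p0 i u) (p0 i v).
Proof. by move=> c; rewrite /= (pcompE c). Qed.

Lemma p1_comp j i (p : ltT j i) (u v : pgpd i) : composable p u v ->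
  p1 i (comp p u v) = comp p (p1 i u) (p1 i v).
Proof. by move=> c; rewrite /= (pcompE c). Qed.

Definition proj0 : gpdmap pgpd H := @Gpdmap pgpd H p0 p0_comp (fun _ _ => erefl).
Definition proj1 : gpdmap pgpd H := @Gpdmap pgpd H p1 p1_comp (fun _ _ => erefl).

End Projections.

End HomotopyGroupoid.

(** * Homotopic morphisms and homotopy groups *)

Section Transfer.

Lemma gpdmap_iid (G H : infgpd) (f : gpdmap G H) j i (p : ltT j i) (x : G j) :
  f i (iid p x) = iid p (f j x).
Proof. by elim: p => [|{}i p IH] /=; rewrite gpdmap_ident // IH. Qed.

Lemma gpdmap_degen (G H : infgpd) (f : gpdmap G H) j i (q : ltT j i) (x : G j.+1) :
  f i (degen q x) = degen q (f j.+1 x).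
Proof. by elim: q => [//|{}i q IH] /=; rewrite gpdmap_ident IH. Qed.

Lemma gpdmap_idn (G H : infgpd) (f : gpdmap G H) n (x : G 0) :
  f n (idn n x) = idn n (f 0 x).
Proof. by elim: n => [//|n IH] /=; rewrite gpdmap_ident IH. Qed.

Lemma iid_idn (G : infcat) j i (p : ltT j i) (x : G 0) : iid p (idn j x) = idn i x.
Proof. by elim: p => [//|{}i p IH] /=; congr ident. Qed.

Lemma isrc_idn (G : infcat) j i (p : ltT j i) (x : G 0) : isrc p (idn i x) = idn j x.
Proof. by rewrite -(iid_idn p) isrc_iident. Qed.

(** [f] induces trivial maps on pi_0 and on all homotopy groups.  The identity
    of [G] has this property exactly when [G] is weakly contractible. *)
Definition pi_trivial (G H : infgpd) (f : gpdmap G H) : Prop :=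
  (exists x0, forall x : G 0, sim (f 0 x) x0) /\
  (forall n (x : G 0) (a : loop n x), sim (f _ a) (ident (idn n (f 0 x)))).

(** All iterated sources of a cell factor through its source. *)
Lemma isrc_src (G : globset) j n (q : ltT j n.+1) (u v : G n.+1) :
  src u = src v -> isrc q u = isrc q v.
Proof.
case: (dimP j n) => [r|e|r]; first by case: (ltT_asymS r q).
  by subst n; rewrite (ltT_irr q ltT_base).
by rewrite (ltT_irr q (ltT_S r)) /= => ->.
Qed.

Variables (H : infgpd) (k : nat).
Local Notation P := (pgpd H k).

(** Over the iterated identity of an object both sides of the square are the
    same cell, which is why the ends of a loop are conjugate. *)
Lemma link_idn n (x : P 0) : link_s (idn n x) = link_t (idn n x).
Proof.
elim: n => [|n IH] //=.
have p : ltT 0 k.+1 by exact: ltT_of.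
by have [] := pv_le (pcellP x) p.
Qed.

Lemma pcell_low m (u : P m) : ltT m k -> end1 u = end0 u.
Proof.
move=> r; have [_ <- <-] := pv_le (pcellP u) (ltT_S r).
by rewrite (pv_lt (pcellP u) r) isrc_iident itgt_iident.
Qed.

Lemma pcell_sim m (u : P m) : ltT m k.+1 -> sim (end0 u) (end1 u).
Proof.
move=> p; case: (dimP k m) => [r|e|q]; last by case: (ltT_asymS q p).
  by rewrite pcell_low //; exact: sim_refl.
move: u p; rewrite e => u p; have [_ e0 e1] := pv_le (pcellP u) ltT_base.
by exists (link_s u).
Qed.

(** Up to dimension k the ends are equal or joined by a link.  Above, the square
    of a loop has equal sides c, so that end0 is c^-1 o_k end1 o_k c, and
    conjugating by c carries a trivialization of end1 to one of end0. *)
Lemma loop_transfer n (x : P 0) (a : loop n x) :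
  sim (end1 (a : P _)) (ident (idn n (end1 x))) ->
  sim (end0 (a : P _)) (ident (idn n (end0 x))).
Proof.
have sa := loop_src a; have ta := loop_tgt a.
have ex0 : idn n (end0 x) = src (end0 (a : P _)).
  by have /= -> := congr1 (@end0 _ _ _) sa; exact/esym/(gpdmap_idn (proj0 H k)).
have ex1 : idn n (end1 x) = src (end1 (a : P _)).
  by have /= -> := congr1 (@end1 _ _ _) sa; exact/esym/(gpdmap_idn (proj1 H k)).
have low : ltT n.+1 k.+1 -> sim (end1 (a : P _)) (ident (idn n (end1 x))) ->
    sim (end0 (a : P _)) (ident (idn n (end0 x))).
  move=> p; have r : ltT n k by apply: ltT_of; have := ltT_lt p.
  have [[e _ _] _] := pcell_faces (a : P _) ltT_base r.
  by rewrite ex1 ex0 [src (end1 _)]e; apply: sim_trans; exact: pcell_sim.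
case: (dimP k n.+1) => [q|e|q]; first by apply: low; exact: ltT_S.
  by apply: low; rewrite e; exact: ltT_base.
have [e1 e2 e3 e4 e5] := pv_gt (pcellP (a : P _)) q.
have ec : link_t (a : P _) = link_s (a : P _).
  have nk : ltT n k -> False by move=> r; case: (ltT_asymS r q).
  have <- : link_s (src (a : P _)) = link_s (a : P _).
    by rewrite /= /link_s_face; case: (dimP k n).
  have <- : link_t (tgt (a : P _)) = link_t (a : P _).
    by rewrite /= /link_t_face; case: (dimP k n).
  by rewrite sa ta link_idn.
rewrite ec in e2 e4 e5; set c := link_s _ in e1 e2 e3 e4 e5.
have [c' [c's c't cc' c'c]] := gpd_inv c.
have i0 : src c = idn k (end0 x).
  by rewrite -e1 -(isrc_idn q); apply: isrc_src; rewrite -ex0 src_ident.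
have i1 : tgt c = idn k (end1 x).
  by rewrite -e3 -(isrc_idn q); apply: isrc_src; rewrite -ex1 src_ident.
set A := degen q c in e5; pose A' := degen q c'.
have AA' : composable q A' A by rewrite /composable isrc_degen itgt_degen.
have A'1 : comp q A' A = ident (idn n (end0 x)).
  by rewrite -degen_comp_base // c'c degen_ident i0 iid_idn.
have A'end1 : composable q A' (end1 (a : P _)) by rewrite /composable isrc_degen c's e4.
have end1A : composable q (end1 (a : P _)) A by rewrite /composable e3 itgt_degen.
have Aend0 : composable q A (end0 (a : P _)) by rewrite /composable isrc_degen e2.
have end0E : comp q A' (comp q (end1 (a : P _)) A) = end0 (a : P _).
  rewrite e5 -compA // A'1; have := comp_identl q (end0 (a : P _)).
  by rewrite e2 i0 iid_idn.
case=> g [gs gt].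
have gA : composable (ltT_S q) g (ident A).
  by rewrite /composable /= gs e3 tgt_ident itgt_degen.
have A'gA : composable (ltT_S q) (ident A') (comp (ltT_S q) g (ident A)).
  by rewrite /composable itgt_comp // /= -itgt_globS gs src_ident isrc_degen c's e4.
exists (comp (ltT_S q) (ident A') (comp (ltT_S q) g (ident A))).
rewrite !(src_comp_S, tgt_comp_S) // !src_ident !tgt_ident gs gt; split=> //.
have -> : comp q (ident (idn n (end1 x))) A = A; last by [].
have := comp_identl q A; rewrite itgt_degen i1.
by rewrite iid_idn.
Qed.

Lemma pi_trivial_transfer (G : infgpd) (M : gpdmap G P) :
  pi_trivial (gpdmap_o (proj1 H k) M) -> pi_trivial (gpdmap_o (proj0 H k) M).
Proof.
case=> [[x0 h0] h]; split=> [|n x a].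
  exists x0 => x; apply: sim_trans (h0 x); apply: pcell_sim; exact: ltT_of.
have sa : src (M _ (loop_arrow a)) = idn n (M 0 x).
  by rewrite -gfun_src loop_src gpdmap_idn.
have ta : tgt (M _ (loop_arrow a)) = idn n (M 0 x).
  by rewrite -gfun_tgt loop_tgt gpdmap_idn.
exact: (@loop_transfer n (M 0 x) (Loop sa ta)) (h n x a).
Qed.

End Transfer.

(** * Constant homotopies and the contraction of an arrow to its target *)

Section TrivialCells.
Variables (H : infgpd) (k : nat).
Local Notation P := (pgpd H k).

Definition triv_link b m (w : H m) : H k.+1 :=
  match dimP k m with
  | DimLt q => iid (ltT_S q) w
  | DimEq e => ident (eq_rect m H w k e)
  | DimGt q => ident (if b then isrc q w else itgt q w)
  end.

Lemma triv_valid m (w : H m) : pvalid w w (triv_link true w) (triv_link false w).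
Proof.
case: (dimP k m) => [q|e|q].
- by rewrite /triv_link (dimP_lt q); exact: pvalid_lt.
- subst m; rewrite /triv_link dimP_eq /=.
  by have := pvalid_eq (ident w); rewrite src_ident tgt_ident.
- rewrite /triv_link (dimP_gt q); apply: (pvalid_gt (q := q)).
  split; rewrite ?src_ident ?tgt_ident // !degen_ident.
  by rewrite [LHS]comp_identr [RHS]comp_identl.
Qed.

Definition triv_cell m (w : H m) : P m := PCell (triv_valid w).

Lemma triv_src m (w : H m.+1) : triv_cell (src w) = src (triv_cell w).
Proof.
apply: pcell_ext => [||nk] //=; rewrite /link_s_face /link_t_face /= /triv_link.
case: (dimP k m) => [//|e|q]; last by rewrite (dimP_gt (ltT_S q)) /= itgt_globS.
by subst m; rewrite (dimP_gt ltT_base).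
Qed.

Lemma triv_tgt m (w : H m.+1) : triv_cell (tgt w) = tgt (triv_cell w).
Proof.
apply: pcell_ext => [||nk] //=; rewrite /link_s_face /link_t_face /= /triv_link.
case: (dimP k m) => [//|e|q]; last by rewrite (dimP_gt (ltT_S q)) /= isrc_globS.
by subst m; rewrite (dimP_gt ltT_base).
Qed.

Definition triv : gmap H P := @Gmap H P triv_cell triv_src triv_tgt.

Lemma square_valid (y : H k.+1) : pvalid y (ident (tgt y)) y (ident (tgt y)).
Proof. by apply: (pvalid_gt (q := ltT_base)); split; rewrite /= ?src_ident ?tgt_ident. Qed.

(** The homotopy of level [k] from [y] to the identity on its target: the link
    over the source is [y] itself, and it is constant over the target. *)
Definition square (y : H k.+1) : P k.+1 := PCell (square_valid y).

Lemma tgt_square (y : H k.+1) : tgt (square y) = triv k (tgt y).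
Proof.
apply: pcell_ext => [||_] /=; rewrite ?tgt_ident //.
by rewrite /link_s_face /link_t_face /= /triv_link !dimP_eq.
Qed.

End TrivialCells.

(** * Morphisms out of the free groupoid as glued families *)

Section Families.
Variable T : table.
Local Notation w := (width T).
Local Notation lo := (widen_ord (leqnSn w)).
Local Notation hi := (lift ord0).

Definition cutl (l : 'I_w) : ltT (cuts l) (dims (lo l)) := ltT_of (cuts_ltl l).
Definition cutr (l : 'I_w) : ltT (cuts l) (dims (hi l)) := ltT_of (cuts_ltr l).

Definition family (X : nat -> Type) := forall l : 'I_w.+1, X (dims l).

Definition glued (X : globset) (z : family X) :=
  forall l, isrc (cutl l) (z (lo l)) = itgt (cutr l) (z (hi l)).

(** The globe after [l] is reduced to the face along which it is glued. *)
Definition tail_at (K : infcat) (z : family K) (l : 'I_w) :=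
  z (hi l) = iid (cutr l) (isrc (cutl l) (z (lo l))).

Lemma val_hi (l : 'I_w) : hi l = l.+1 :> nat.
Proof. by []. Qed.

Lemma tail_glued (K : infcat) (z : family K) l : tail_at z l ->
  isrc (cutl l) (z (lo l)) = itgt (cutr l) (z (hi l)).
Proof. by move=> ->; rewrite itgt_iident. Qed.

(** Collapsing all the globes after the [n]-th one, in order. *)
Lemma extend_tail (K : infcat) (z : family K) (n : nat) : exists z' : family K,
  (forall l : 'I_w.+1, l <= n -> z' l = z l) /\
  (forall l : 'I_w, n <= l -> tail_at z' l).
Proof.
suff [z' [e t]] : exists z' : family K,
    (forall l : 'I_w.+1, l <= n -> z' l = z l) /\
    (forall l : 'I_w, n <= l < n + w -> tail_at z' l).
  exists z'; split=> // l nl; apply: t; rewrite nl /=.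
  exact: leq_trans (ltn_ord l) (leq_addl _ _).
elim: (w in n + w) => [|m [z' [e t]]].
  by exists z; split=> // l /andP[a b]; move: (leq_ltn_trans a b); rewrite addn0 ltnn.
(* beyond the last cut there is nothing left to modify *)
have [h|h] := ltnP (n + m) w; last first.
  exists z'; split=> // l /andP[nl _]; apply: t; rewrite nl /=.
  exact: leq_trans (ltn_ord l) h.
pose l0 := Ordinal h.
pose v : K (dims (hi l0)) := iid (cutr l0) (isrc (cutl l0) (z' (lo l0))).
pose z2 : family K := @dfwith _ (fun l => K (dims l)) z' _ v.
have out (l : 'I_w.+1) : l <= n + m -> z2 l = z' l.
  move=> h'; rewrite /z2 dfwith_out //; apply: contraTneq h' => <-.
  by rewrite val_hi /= ltnn.
exists z2; split=> [l nl|l /andP[nl]].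
  by rewrite out ?e // (leq_trans nl) ?leq_addr.
rewrite addnS ltnS leq_eqVlt => /orP[/eqP el|lm].
  have -> : l = l0 by exact: val_inj.
  by rewrite /tail_at [in RHS]out // /z2 dfwith_in.
by rewrite /tail_at !out ?val_hi ?(ltnW lm) //; apply: t; rewrite nl.
Qed.

Lemma tail_uniq (K : infcat) (z z' : family K) (n : nat) :
  (forall l : 'I_w.+1, l <= n -> z l = z' l) ->
  (forall l : 'I_w, n <= l -> tail_at z l) ->
  (forall l : 'I_w, n <= l -> tail_at z' l) -> forall l, z l = z' l.
Proof.
move=> e t t' l; have [m] := ubnP (val l); elim: m l => // m IH l lm.
have [ln|nl] := leqP l n; first exact: e.
case: (unliftP ord0 l) => [l' el|el]; last by rewrite el in nl.
subst l; rewrite val_hi in lm nl.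
by rewrite t // t' // IH.
Qed.

Lemma gpdmap_tail (G K : infgpd) (f : gpdmap G K) (z : family G) l :
  tail_at z l -> tail_at (fun l => f _ (z l)) l.
Proof. by rewrite /tail_at => ->; rewrite gpdmap_iid gfun_isrc. Qed.

Lemma gmap_glued (X Y : globset) (f : gmap X Y) (z : family X) :
  glued z -> glued (fun l => f _ (z l)).
Proof. by move=> g l; rewrite -gfun_isrc g gfun_itgt. Qed.

(** The Yoneda lemma on the two iterated faces of the universal n-cell. *)
Lemma globe_face X n j (p : ltT j n) (f : gmap (globe n) X) b :
  f j (ghom_face b p) = if b then isrc p (f n ghom_id) else itgt p (f n ghom_id).
Proof.
by case: b; rewrite -?gfun_isrc -?gfun_itgt ?globe_isrc ?globe_itgt.
Qed.

Lemma cocone_glued (X : globset) (c : cocone T X) :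
  glued (fun l => coproj c l _ ghom_id).
Proof.
move=> l.
have /(congr1 (fun f : gmap (globe (cuts l)) X => f _ ghom_id)) /= := coproj_glue c l.
by rewrite !globe_face.
Qed.

Lemma cocone_of (X : globset) (z : family X) : glued z ->
  exists d : cocone T X, forall l, coproj d l _ ghom_id = z l.
Proof.
move=> g.
have F l : exists f : gmap (globe (dims l)) X, f _ ghom_id = z l.
  by have [f [e _]] := yoneda (z l); exists f.
pose q l := sval (cid (F l)).
have qE l : q l _ ghom_id = z l by rewrite /q; case: cid.
suff h l : gmap_comp (q (lo l)) (left_leg l) = gmap_comp (q (hi l)) (right_leg l).
  by exists (Cocone h).
have [f [_ u]] := yoneda (isrc (cutl l) (z (lo l))).
apply: etrans (esym (u _ _)) (u _ _); first by rewrite /= globe_face qE.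
by rewrite /= globe_face qE g.
Qed.

(** The universal property of L(G_T), stated in terms of the cells that
    correspond to the top cells of the globes. *)
Record free_on (G : infgpd) (C : family G) : Prop := FreeOn {
  free_glued : glued C;
  free_ex : forall (K : infgpd) (z : family K), glued z ->
    exists f : gpdmap G K, forall l, f _ (C l) = z l;
  free_uniq : forall (K : infgpd) (f g : gpdmap G K),
    (forall l, f _ (C l) = g _ (C l)) -> f = g }.

Lemma free_on_sum (L : left_adjoint) (X : globset) (c : cocone T X) :
  is_globular_sum c -> exists C : family (free L X), free_on C.
Proof.
move=> hc; pose eta := transpose (gpdmap_id (free L X)).
have tr (K : infgpd) (f : gpdmap (free L X) K) : transpose f = gmap_comp f eta.
  by rewrite -transpose_natr; congr transpose; exact: gpdmap_ext.
exists (fun l => eta _ (coproj c l _ ghom_id)); split.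
- exact: (gmap_glued _ (cocone_glued c)).
- move=> K z /cocone_of[d dz]; have [f [fd _]] := hc K d.
  have [g _ gK] := transpose_bij L X K.
  exists (g f) => l; rewrite -dz -fd /=.
  by have /(congr1 (fun h : gmap _ _ => h _ (coproj c l _ ghom_id))) := tr _ (g f); rewrite gK.
- move=> K f g e; apply: (bij_inj (transpose_bij L X K)); rewrite !tr.
  have [d dE] := cocone_of (gmap_glued (gmap_comp f eta) (cocone_glued c)).
  have [h [_ u]] := hc K d.
  have ext l (p q : gmap (globe (dims l)) K) : p _ ghom_id = q _ ghom_id -> p = q.
    have [x [_ ux]] := yoneda (q _ ghom_id) => e'.
    by apply: etrans (esym (ux _ _)) (ux _ _).
  by apply: etrans (esym (u _ _)) (u _ _) => l; apply: ext; rewrite dE //= -e.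
Qed.

(** * Collapsing the globes one dimension at a time *)

Section Collapse.
Variables (G : infgpd) (C : family G).
Hypothesis freeC : free_on C.

Definition collapse j i (x : G i) : G i :=
  if dimP j i is DimGt q then iid q (itgt q x) else x.

(** The endomorphism with these values on the [C m] exists and is unique when
    the values are glued; quantifying over [f] avoids proving gluing for each
    stage separately. *)
Definition stage (l : 'I_w.+1) (v : G (dims l)) := forall f : gpdmap G G,
  (forall m : 'I_w.+1, m < l -> f _ (C m) = C m) -> f _ (C l) = v ->
  (forall m : 'I_w, l <= m -> tail_at (fun m => f _ (C m)) m) -> pi_trivial f.

Definition point_map (x : G 0) : gmap G G.
Proof.
by apply: (@Gmap G G (fun i _ => idn i x)) => i _; rewrite /= ?src_ident ?tgt_ident.
Defined.

Lemma comp_idn (x : G 0) j i (p : ltT j i) : comp p (idn i x) (idn i x) = idn i x.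
Proof. by rewrite -(iid_idn p) comp_iid. Qed.

Definition point_gpdmap (x : G 0) : gpdmap G G :=
  @Gpdmap G G (point_map x) (fun j i p _ _ _ => esym (comp_idn x p)) (fun i _ => erefl).

Lemma pi_trivial_point x : pi_trivial (point_gpdmap x).
Proof.
split=> [|n y a]; first by exists x => y; exact: sim_refl.
rewrite /=; have -> : idn n x = idn n (idn 0 x) by []. exact: sim_refl.
Qed.

Lemma collapse0 i (x : G i) : exists x0, collapse 0 x = idn i x0.
Proof.
rewrite /collapse; case: (dimP 0 i) => [q|e|q]; first by have := ltT_lt q.
  by subst i; exists x.
by exists (itgt q x); rewrite (iid_idn q).
Qed.

Lemma collapse_ge j i (x : G i) : i <= j -> collapse j x = x.
Proof.
by move=> h; rewrite /collapse; case: dimP => // q; have := ltT_lt q; rewrite ltnNge h.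
Qed.

Lemma collapseE j i (q : ltT j i) (x : G i) : collapse j x = iid q (itgt q x).
Proof. by rewrite /collapse (dimP_gt q). Qed.

(** Collapsing to dimension j after collapsing to dimension j+1 moves a single
    (j+1)-cell [y] to the identity on its target. *)
Lemma collapseS j i (q : ltT j i) (x : G i) :
  exists y, collapse j.+1 x = degen q y /\ tgt y = itgt q x.
Proof.
rewrite /collapse; case: (dimP j.+1 i) => [r|e|r]; first by case: (ltT_asymS q r).
  by subst i; exists x; rewrite (ltT_irr q ltT_base).
exists (itgt r x); rewrite (degen_iid q r); split=> //.
by rewrite -(isrc_pred r x).2; congr itgt; exact: ltT_irr.
Qed.

Lemma stage0 : stage (collapse 0 (C ord0)).
Proof.
move=> f _ f0 ft; have [x0 e0] := collapse0 (C ord0).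
suff -> : f = point_gpdmap x0 by exact: pi_trivial_point.
apply: (free_uniq freeC); apply: (@tail_uniq G _ _ 0) => [l|l _|l _].
- rewrite leqn0 => /eqP l0; have -> : l = ord0 by exact: val_inj.
  by rewrite f0.
- exact: ft.
- by rewrite /tail_at /= isrc_idn (iid_idn (cutr l)).
Qed.

(** One elementary collapse.  The homotopy is the morphism M to the path object
    of level [j] given by constant cells on the earlier globes, [square y]
    degenerated on the globe l, and identities afterwards.  It is glued to the
    globe before l because the cut has dimension at most j, and on faces of the
    target of [y] the homotopy is constant. *)
Lemma stage_collapse j (l : 'I_w.+1) : (forall m : 'I_w, hi m = l -> cuts m <= j) ->
  stage (collapse j (C l)) -> stage (collapse j.+1 (C l)).
Proof.
move=> cutj S; case: (dimP j (dims l)) => [q|e|q].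
- by rewrite collapse_ge ?(leqW (ltnW (ltT_lt q))) // -[C l](@collapse_ge j) // ltnW // ltT_lt.
- by rewrite collapse_ge ?e ?leqnSn // -[C l](@collapse_ge j) // e.
move=> f fC fl ft; have [y [ey ty]] := collapseS q (C l).
pose P := pgpd G j.
pose z0 : family P := @dfwith _ (fun l => P (dims l)) (fun l => triv G j _ (C l)) l
  (degen q (square y : P _)).
have z0l : z0 l = degen q (square y : P _) by rewrite /z0 dfwith_in.
have z0C (m : 'I_w.+1) : m < l -> z0 m = triv G j _ (C m).
  by move=> ml; rewrite /z0 dfwith_out //; apply: contraTneq ml => <-; rewrite ltnn.
have [z [ze zt]] := extend_tail z0 l.
have zg : glued z.
  move=> m; have [lm|ml] := leqP l m; first exact: tail_glued (zt m lm).
  rewrite !ze ?(ltnW ml) // (z0C (lo m) ml).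
  have [hl|hl] : hi m < l \/ l = hi m.
  - by move: ml; rewrite leq_eqVlt => /orP[/eqP e|]; [right; exact/val_inj/esym|left].
  - by rewrite z0C // -gfun_isrc (free_glued freeC) gfun_itgt.
  - subst l; rewrite z0l -gfun_isrc (free_glued freeC).
    case: (dimP j (cuts m)) => [r|e|r].
    3: by have := cutj m erefl; rewrite leqNgt (ltT_lt r).
    + rewrite (ltT_irr (cutr m) (ltT_trans r q)) !itgt_trans itgt_degen.
      by rewrite [tgt (square y)]tgt_square gfun_itgt -ty.
    + subst j; rewrite (ltT_irr (cutr m) q) itgt_degen.
      by rewrite [tgt (square y)]tgt_square ty.
have [M Mz] := free_ex freeC zg.
have -> : f = gpdmap_o (proj0 G j) M.
  apply: (free_uniq freeC); apply: (@tail_uniq G _ _ l) => [m|//|m lm].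
  - rewrite leq_eqVlt => /orP[/eqP/val_inj->|ml].
      by rewrite fl ey /= Mz ze // z0l; have /= -> := gpdmap_degen (proj0 G j) q (square y).
    by rewrite fC //= Mz ze ?(ltnW ml) // z0C.
  - apply: (gpdmap_tail (proj0 G j) (z := fun l => M _ (C l))).
    by rewrite /tail_at !Mz; exact: zt.
apply: pi_trivial_transfer; apply: S => [m ml||m lm].
- by rewrite /= Mz ze ?(ltnW ml) // z0C.
- rewrite /= Mz ze // z0l; have /= -> := gpdmap_degen (proj1 G j) q (square y).
  by rewrite degen_ident (collapseE q) ty.
- apply: (gpdmap_tail (proj1 G j) (z := fun l => M _ (C l))).
  by rewrite /tail_at !Mz; exact: zt.
Qed.

Lemma stage_full j (l : 'I_w.+1) : (forall m : 'I_w, hi m = l -> cuts m <= j) ->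
  stage (collapse j (C l)) -> stage (C l).
Proof.
move=> cutj S.
have h n : stage (collapse (n + j) (C l)).
  elim: n => [//|n IH]; rewrite addSn; apply: stage_collapse => // m e.
  exact: leq_trans (cutj m e) (leq_addl _ _).
by have := h (dims l); rewrite collapse_ge // leq_addr.
Qed.

(** Collapsed to the dimension of its cut, the globe after l is the identity on
    the face along which it is glued to the globe l: it has become a part of the
    tail behind the intact globe l. *)
Lemma stage_glue (l : 'I_w) : stage (C (lo l)) -> stage (collapse (cuts l) (C (hi l))).
Proof.
move=> S f fC fl ft; apply: S => [m ml||m lm].
- by apply: fC; rewrite val_hi; exact: ltnW.
- by apply: fC.
have [e|ne] := eqVneq m l; last by apply: ft; rewrite val_hi ltn_neqAle eq_sym ne.
subst m; rewrite /tail_at fl (collapseE (cutr l)) fC //.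
by rewrite (free_glued freeC).
Qed.

Lemma stage_all (l : 'I_w.+1) : stage (C l).
Proof.
have [m] := ubnP (val l); elim: m l => // m IH l lm.
(* the first globe has no cut and is collapsed down to dimension 0 *)
case: (unliftP ord0 l) => [l' el|el]; subst l.
  apply: (@stage_full (cuts l')); first by move=> m' /lift_inj ->.
  by apply: stage_glue; apply: IH; exact: lm.
by apply: stage_full stage0 => m' e; have := congr1 val e.
Qed.

Lemma pi_trivial_id : pi_trivial (gpdmap_id G).
Proof.
apply: (stage_all (l := ord_max)) => // m; rewrite leqNgt /=.
by rewrite ltn_ord.
Qed.

Lemma free_contractible : weakly_contractible G.
Proof.
have [[x0 h0] h] := pi_trivial_id; split.
  by exists (cls _ x0) => b; rewrite -(reprK b); apply/pi0P; exact: h0.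
by move=> n x a; rewrite -(reprK a); apply/piSP; exact: h.
Qed.

End Collapse.
End Families.

Theorem theorem6p1 (L : left_adjoint) (T : table) (G_T : globset)
    (c : cocone T G_T) (hc : is_globular_sum c) :
  weakly_contractible (free L G_T).
Proof. by have [C /free_contractible] := free_on_sum L hc. Qed.
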